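(* Consider the dynamical system, trajectory space $\mathcal{S}$, charts $\Phi_t$ and models $\mathfrak{p}_t$ described in the context, with $f(\cdot,u_t)$ a diffeomorphism of $\mathbb{R}^{\dim(s)}$ for every $t$. Fix an initial state $s_0$, inputs $(u_t)_{t\ge1}$ and observations $(y_t)_{t\ge1}$. Let $s_t$ be the state estimated at time $t$ by the pure fading-memory extended Kalman filter with weights $(\alpha_t)$, observations $(y_t)$, initial state $s_0$ and initial covariance $P_0$ (symmetric positive definite). Let $\mathbf{s}^t\in\mathcal{S}$ be the trajectory estimated after $t$ steps of the online natural gradient in charts for the models $\mathfrak{p}_t$ in the charts $\Phi_t$, initialized at the trajectory $\mathbf{s}^0$ with $\mathbf{s}^0_0=s_0$, and with initial metric whose matrix in chart $\Phi_0$ is $J_0$ (symmetric positive definite). Assume the hyperparameters are related by $$P_0=\eta_0 J_0^{-1},\qquad \gamma_t=\eta_t,\qquad \frac1{\eta_t}=\frac{1}{1+\alpha_t}\,\frac1{\eta_{t-1}}+1\quad (t\ge1).$$ Then for all $t\ge0$, $\Phi_t(\mathbf{s}^t)=\mathbf{s}^t_t=s_t$, and $P_t=\eta_t J_t^{-1}$, where $J_t$ is the matrix of the metric tensor $\mathcal{J}_t$ in the chart $\Phi_t$.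
   Context: Conventions: for $y=f(x)$, $\partial y/\partial x$ is the Jacobian with $(i,j)$ entry $\partial f_i/\partial x_j$; gradients of real functions are row vectors; for a column vector $v$, $v^{\otimes2}=vv^\top$, and for a row vector $v$, $v^{\otimes 2}=v^\top v$. Exponential family: $p_{\mathrm{obs}}(y\mid\hat y)$ denotes a family of densities $\frac{1}{Z(\beta)}\exp(\sum_k\beta_kT_k(y))\lambda(dy)$ (reference measure $\lambda$, linearly independent sufficient statistics $T=(T_1,\dots,T_K)$, also independent from constants), parameterized by its mean parameter $\hat y=\mathbb{E}[T(y)]\in\mathbb{R}^K$ (e.g. $\mathcal N(\hat y,R)$ with fixed $R$). Dynamical system: states $s_t\in\mathbb{R}^{\dim(s)}$, inputs $u_t$, smooth $f$ with $s_t=f(s_{t-1},u_t)$; smooth $h$ with predictions $\hat y_t=h(s_t,u_t)$; observations $y_t\sim p_{\mathrm{obs}}(y\mid\hat y_t)$. $\mathcal S$ is the set of sequences $\mathbf{s}=(s_t)_{t\ge0}$ with $s_t=f(s_{t-1},u_t)$ for all $t\ge1$; $\Phi_t:\mathcal S\to\mathbb{R}^{\dim(s)}$, $\Phi_t(\mathbf{s})=s_t$ (a chart on the manifold $\mathcal S$); $\mathfrak{p}_t(y\mid\mathbf{s}):=p_{\mathrm{obs}}(y\mid h(\Phi_t(\mathbf{s}),u_t))$. Online natural gradient in charts: on a smooth manifold $\Theta$ with models $\mathfrak p_t(y\mid\vartheta)$ and charts $\Phi_t:\Theta\to\mathbb{R}^{\dim\Theta}$ (for a tensor $g$, $\mathbf{T}\Phi(g)$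 is its coordinate expression in chart $\Phi$, and $\mathbf T_\vartheta\Phi^{-1}$ the inverse operation at $\vartheta$), the algorithm maintains $\vartheta_t\in\Theta$ and a $(0,2)$-tensor $\mathcal J_t$ at $\vartheta_t$, updated for $t\ge1$ with learning rate $\eta_t$ and decay rate $\gamma_t$ by: $\theta\leftarrow\Phi_t(\vartheta_{t-1})$, $J\leftarrow\mathbf T\Phi_t(\mathcal J_{t-1})$; $J_t\leftarrow(1-\gamma_t)J+\gamma_t\mathbf T\Phi_t\big(\mathbb E_{y\sim\mathfrak p_t(\cdot\mid\vartheta_{t-1})}[(\partial\ln\mathfrak p_t(y\mid\vartheta)/\partial\vartheta|_{\vartheta_{t-1}})^{\otimes2}]\big)$; $\theta_t\leftarrow\theta+\eta_tJ_t^{-1}\mathbf T\Phi_t(\partial\ln\mathfrak p_t(y_t\mid\vartheta)/\partial\vartheta|_{\vartheta_{t-1}})^\top$; $\vartheta_t\leftarrow\Phi_t^{-1}(\theta_t)$, $\mathcal J_t\leftarrow\mathbf T_{\vartheta_t}\Phi_t^{-1}(J_t)$. Here $\vartheta_t=\mathbf s^t$. Extended Kalman filter (with exponential-family observations): maintains $s_t$ and covariance $P_t$, starting from $(s_0,P_0)$; for $t\ge1$: $s_{t|t-1}=f(s_{t-1},u_t)$, $F_{t-1}=\partial f/\partial s|_{(s_{t-1},u_t)}$, $P_{t|t-1}=F_{t-1}P_{t-1}F_{t-1}^\top+Q_t$, $\hat y_t=h(s_{t|t-1},u_t)$, $E_t=T(y_t)-\hat y_t$, $R_t=\mathrm{Cov}_{y\sim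 p_{\mathrm{obs}}(\cdot\mid\hat y_t)}(T(y))$, $H_t=\partial h/\partial s|_{(s_{t|t-1},u_t)}$, $K_t=P_{t|t-1}H_t^\top(H_tP_{t|t-1}H_t^\top+R_t)^{-1}$, $P_t=(\mathrm{Id}-K_tH_t)P_{t|t-1}$, $s_t=s_{t|t-1}+K_tE_t$. The pure fading-memory filter with weights $\alpha_t\ge0$ takes $Q_t=\alpha_tF_{t-1}P_{t-1}F_{t-1}^\top$, i.e. $P_{t|t-1}=(1+\alpha_t)F_{t-1}P_{t-1}F_{t-1}^\top$. *)

(* Defs.v *)
From HB Require Import structures.
From mathcomp Require Import all_boot all_order all_algebra.
From mathcomp Require Import all_classical all_reals all_analysis.
Set Implicit Arguments. Unset Strict Implicit. Unset Printing Implicit Defensive.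
Import Order.TTheory GRing.Theory Num.Theory.
Import numFieldNormedType.Exports.
Local Open Scope classical_set_scope.
Local Open Scope ring_scope.

Section Calculus.
Variable R : realType.

Definition Jac (n m : nat) (f : 'cV[R]_n -> 'cV[R]_m) (x : 'cV[R]_n)
  : 'M[R]_(m, n) :=
  \matrix_(i, j) ('d f x (delta_mx j 0) : 'cV[R]_m) i 0.

Definition grad (n : nat) (g : 'cV[R]_n -> R) (x : 'cV[R]_n) : 'rV[R]_n :=
  \row_j ('d g x (delta_mx j 0) : R).

Definition spd (n : nat) (M : 'M[R]_n) : Prop :=
  M^T = M /\ forall v : 'cV[R]_n, v != 0 -> 0 < (v^T *m M *m v) 0 0.

(* Coordinate expression of a (0,2)-tensor in a new chart, given its matrix
   [Jold] in an old chart, where [tau] = (old chart) o (new chart)^-1 and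
   [theta] is the new-chart coordinate of the base point. *)
Definition tensor_chart_change (n : nat) (tau : 'cV[R]_n -> 'cV[R]_n)
  (theta : 'cV[R]_n) (Jold : 'M[R]_n) : 'M[R]_n :=
  (Jac tau theta)^T *m Jold *m Jac tau theta.
End Calculus.

Section ExpFamily.
Variables (R : realType) (d : measure_display) (Y : measurableType d).
Variable lam : {measure set Y -> \bar R}.
Variable K : nat.
Variable T : Y -> 'cV[R]_K.

Definition expfam_Z (beta : 'cV[R]_K) : \bar R :=
  (\int[lam]_y (expR ((beta^T *m T y) 0 0))%:E)%E.

Definition expfam_natparam : set 'cV[R]_K :=
  [set beta | (expfam_Z beta < +oo)%E].

Definition expfam_dens (beta : 'cV[R]_K) (y : Y) : R :=
  expR ((beta^T *m T y) 0 0) / fine (expfam_Z beta).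

Definition expfam_mean (beta : 'cV[R]_K) : 'cV[R]_K :=
  \col_k (\int[lam]_y (T y k 0 * expfam_dens beta y)).

Definition expfam_valid_nat (yhat : 'cV[R]_K) : set 'cV[R]_K :=
  [set beta | interior expfam_natparam beta /\ expfam_mean beta = yhat].

Definition expfam_meanspace : set 'cV[R]_K :=
  [set yhat | exists beta, expfam_valid_nat yhat beta].

(* natural parameter corresponding to the mean parameter yhat
   (unique under the minimality assumption) *)
Definition expfam_nat_of_mean (yhat : 'cV[R]_K) : 'cV[R]_K :=
  xget 0 (expfam_valid_nat yhat).

Definition p_obs (yhat : 'cV[R]_K) (y : Y) : R :=
  expfam_dens (expfam_nat_of_mean yhat) y.

Definition Eobs (yhat : 'cV[R]_K) (g : Y -> R) : R :=
  \int[lam]_y (g y * p_obs yhat y).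

Definition EobsM (m p : nat) (yhat : 'cV[R]_K) (G : Y -> 'M[R]_(m, p))
  : 'M[R]_(m, p) := \matrix_(i, j) Eobs yhat (fun y => G y i j).

Definition covT (yhat : 'cV[R]_K) : 'M[R]_K :=
  EobsM yhat (fun y => (T y - yhat) *m (T y - yhat)^T).

Definition expfam_minimal : Prop :=
  (forall k, measurable_fun setT (fun y => T y k 0)) /\
  (forall (c : 'cV[R]_K) (c0 : R),
     {ae lam, forall y, (c^T *m T y) 0 0 = c0} -> c = 0).
End ExpFamily.

Section Trajectories.
Variables (R : realType) (n : nat) (U : Type).
Variable f : 'cV[R]_n -> U -> 'cV[R]_n.
Variable u : nat -> U.
(* finv t is the inverse of f(., u t) *)
Variable finv : nat -> 'cV[R]_n -> 'cV[R]_n.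

Definition traj_space : set (nat -> 'cV[R]_n) :=
  [set s | forall t, (0 < t)%N -> s t = f (s t.-1) (u t)].

Definition Phi (t : nat) (s : nat -> 'cV[R]_n) : 'cV[R]_n := s t.

(* backward: state at time t - m of the trajectory with s_t = theta *)
Fixpoint traj_back (m t : nat) (theta : 'cV[R]_n) : 'cV[R]_n :=
  match m with
  | 0 => theta
  | m'.+1 => finv (t - m') (traj_back m' t theta)
  end.

(* forward: state at time t + m of the trajectory with s_t = theta *)
Fixpoint traj_fwd (m t : nat) (theta : 'cV[R]_n) : 'cV[R]_n :=
  match m with
  | 0 => theta
  | m'.+1 => f (traj_fwd m' t theta) (u (t + m'.+1))
  end.

Definition Phi_inv (t : nat) (theta : 'cV[R]_n) : nat -> 'cV[R]_n :=
  fun k => if (k <= t)%N then traj_back (t - k) t theta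
           else traj_fwd (k - t) t theta.
End Trajectories.

Section Algorithms.
Variables (R : realType) (d : measure_display) (Y : measurableType d).
Variable lam : {measure set Y -> \bar R}.
Variables (K n : nat) (U : Type).
Variable T : Y -> 'cV[R]_K.
Variable f : 'cV[R]_n -> U -> 'cV[R]_n.
Variable finv : nat -> 'cV[R]_n -> 'cV[R]_n.
Variable h : 'cV[R]_n -> U -> 'cV[R]_K.
Variable u : nat -> U.
Variable y : nat -> Y.

Variable alpha : nat -> R.
Variables (s0 : 'cV[R]_n) (P0 : 'M[R]_n).

Definition Fjac (t : nat) (s : 'cV[R]_n) : 'M[R]_n := Jac (fun x => f x (u t)) s.
Definition Hjac (t : nat) (s : 'cV[R]_n) : 'M[R]_(K, n) := Jac (fun x => h x (u t)) s.

Fixpoint ekf (t : nat) : 'cV[R]_n * 'M[R]_n :=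
  match t with
  | 0 => (s0, P0)
  | t'.+1 =>
    let s := (ekf t').1 in
    let P := (ekf t').2 in
    let tt := t'.+1 in
    let spred := f s (u tt) in
    let F := Fjac tt s in
    let Q := alpha tt *: (F *m P *m F^T) in
    let Ppred := F *m P *m F^T + Q in
    let yhat := h spred (u tt) in
    let E := T (y tt) - yhat in
    let Rt := covT lam T yhat in
    let H := Hjac tt spred in
    let Kt := Ppred *m H^T *m invmx (H *m Ppred *m H^T + Rt) in
    (spred + Kt *m E, (1%:M - Kt *m H) *m Ppred)
  end.

Definition ekf_yhat (t : nat) : 'cV[R]_K :=
  h (f (ekf t.-1).1 (u t)) (u t).

Variables (eta gamma : nat -> R).
Variable J0 : 'M[R]_n.

Definition model (t : nat) (yy : Y) (s : nat -> 'cV[R]_n) : R :=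
  p_obs lam T (h (Phi t s) (u t)) yy.

Definition score_chart (t : nat) (yy : Y) (s : nat -> 'cV[R]_n) : 'rV[R]_n :=
  grad (fun th => ln (model t yy (Phi_inv f u finv t th))) (Phi t s).

(* state: trajectory s^t in S and matrix J_t of the metric in chart Phi_t *)
Fixpoint ngd (t : nat) : (nat -> 'cV[R]_n) * 'M[R]_n :=
  match t with
  | 0 => (Phi_inv f u finv 0 s0, J0)
  | t'.+1 =>
    let tt := t'.+1 in
    let vprev := (ngd t').1 in
    let theta := Phi tt vprev in
    let tau := fun th => Phi t' (Phi_inv f u finv tt th) in
    let J := tensor_chart_change tau theta (ngd t').2 in
    let fisher := EobsM lam T (h (Phi tt vprev) (u tt))
                    (fun yy => (score_chart tt yy vprev)^T *m score_chart tt yy vprev) in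
    let Jt := (1 - gamma tt) *: J + gamma tt *: fisher in
    let thetat := theta + eta tt *: (invmx Jt *m (score_chart tt (y tt) vprev)^T) in
    (Phi_inv f u finv tt thetat, Jt)
  end.
End Algorithms.

(* Main.v *)
Require Import Defs.
From HB Require Import structures.
From mathcomp Require Import all_boot all_order all_algebra.
From mathcomp Require Import all_classical all_reals all_analysis.
From mathcomp Require Import measurable_realfun ring lra.
Import Order.TTheory GRing.Theory Num.Theory.
Import numFieldNormedType.Exports.
Local Open Scope classical_set_scope.
Local Open Scope ring_scope.

(* In an exponential family the score with respect to the mean parameter [yhat]
   is [(T(y) - yhat)^T Cov^-1], because the Jacobian of the mean with respect to
   the natural parameter is the covariance of [T].  Composed with the observation
   map [h] the Fisher matrix is therefore [H^T R^-1 H], and the chart change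
   contributes [F^-T J F^-1], so that the natural gradient update of [J / eta] is
   the information form [P^-1 + H^T R^-1 H] of the Kalman update.

   The analytic content is that the natural parameter is a differentiable function
   of the mean.  With [L g b = int g(y) exp(b . T(y)) dlam(y)], the inequality
   [|e^x - 1 - x| <= x^2 e^|x|] gives a second order Taylor bound for [L g] in the
   interior of the natural parameter space.  The function
   [b |-> int exp(b . (T(y) - yhat)) dlam(y)] has a strict minimum at the natural
   parameter of [yhat]; for [yhat'] close to [yhat] the corresponding function still
   has an interior minimum on a small ball, and its stationarity says that the
   minimizer has mean [yhat'].  The Taylor bound then inverts to first order. *)

(** * Positive definite matrices and the information form of the Kalman update *)

Section SPD.
Context {R : realType}.

(** A nonzero row of the kernel would make the quadratic form vanish. *)
Lemma spd_unitmx {n} {M : 'M[R]_n} : spd M -> M \in unitmx.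
Proof.
move=> [Msym Mpos]; rewrite -row_free_unit -kermx_eq0.
apply/eqP/row_matrixP => i; rewrite row0; apply/eqP/negP => /negP ri0.
have := Mpos (row i (kermx M))^T.
rewrite trmx_eq0 => /(_ ri0); rewrite trmxK.
by rewrite -row_mul mulmx_ker row0 mul0mx mxE ltxx.
Qed.

Lemma spd_scale {n} {M : 'M[R]_n} (a : R) : 0 < a -> spd M -> spd (a *: M).
Proof.
move=> a0 [Ms Mp]; split=> [|v v0]; first by rewrite linearZ /= Ms.
by rewrite -scalemxAr -scalemxAl mxE mulr_gt0 ?Mp.
Qed.

(** Semidefiniteness is what survives congruence by a rectangular [H] that need not be injective. *)
Definition psd {n} (M : 'M[R]_n) : Prop :=
  M^T = M /\ forall v : 'cV[R]_n, 0 <= (v^T *m M *m v) 0 0.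

Lemma spd_psd {n} {M : 'M[R]_n} : spd M -> psd M.
Proof.
move=> [Ms Mp]; split=> // v; have [->|v0] := eqVneq v 0.
  by rewrite mulmx0 mxE.
exact/ltW/Mp.
Qed.

Lemma spdD {n} {M N : 'M[R]_n} : spd M -> psd N -> spd (M + N).
Proof.
move=> [Ms Mp] [Ns Np]; split=> [|v v0]; first by rewrite linearD /= Ms Ns.
by rewrite mulmxDr mulmxDl mxE ltr_wpDr ?Np ?Mp.
Qed.

Lemma psd_congr {m n} {M : 'M[R]_m} (A : 'M[R]_(m, n)) :
  psd M -> psd (A^T *m M *m A).
Proof.
move=> [Ms Mp]; split=> [|v]; first by rewrite !trmx_mul trmxK Ms mulmxA.
by have := Mp (A *m v); rewrite trmx_mul !mulmxA.
Qed.

Lemma spd_congr {n} {M A : 'M[R]_n} :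
  A \in unitmx -> spd M -> spd (A^T *m M *m A).
Proof.
move=> Au [Ms Mp]; split=> [|v v0]; first by rewrite !trmx_mul trmxK Ms mulmxA.
have Av0 : A *m v != 0.
  by apply: contraNneq v0 => Av0; rewrite -(mulKmx Au v) Av0 mulmx0.
by have := Mp (A *m v) Av0; rewrite trmx_mul !mulmxA.
Qed.

(** Congruence of [M] by its own inverse returns the inverse. *)
Lemma spd_inv {n} {M : 'M[R]_n} : spd M -> spd (invmx M).
Proof.
move=> sM; have Mu := spd_unitmx sM; have [Ms _] := sM.
have iMs : (invmx M)^T = invmx M by rewrite trmx_inv Ms.
have := @spd_congr n M (invmx M); rewrite unitmx_inv => /(_ Mu sM).
by rewrite iMs mulVmx // mul1mx.
Qed.

Lemma invmxZ_neq0 {n} (a : R) (M : 'M[R]_n) : a != 0 -> M \in unitmx ->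
  invmx (a *: M) = a^-1 *: invmx M.
Proof. by move=> a0 Mu; rewrite invmxZ // unitmxZ // unitfE. Qed.

Lemma unitmx_mulmx1 {n} {A B : 'M[R]_n} :
  A *m B = 1%:M -> B \in unitmx /\ A = invmx B.
Proof.
move=> AB; have [Au Bu] := mulmx1_unit AB; split=> //.
by rewrite -[A]mulmx1 -(mulmxV Bu) mulmxA AB mul1mx.
Qed.

Section Information.
Context {n k : nat}.
Context {P : 'M[R]_n} {V : 'M[R]_k} {H : 'M[R]_(k, n)}.
Hypotheses (sP : spd P) (sV : spd V).

Let K := P *m H^T *m invmx (H *m P *m H^T + V).

Let SU : H *m P *m H^T + V \in unitmx.
Proof.
apply: spd_unitmx; rewrite addrC; apply: spdD => //.
by rewrite -{1}[H]trmxK; apply/psd_congr/spd_psd.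
Qed.

(** Since [K S = P H^T] with [S = H P H^T + V], subtracting [K H P H^T] leaves
    [(1 - K H) P H^T = K V]. *)
Lemma kalman_gain_information :
  K = (1%:M - K *m H) *m P *m H^T *m invmx V.
Proof.
have Vu := spd_unitmx sV.
have KS : K *m (H *m P *m H^T + V) = P *m H^T by rewrite /K mulmxKV.
suff -> : (1%:M - K *m H) *m P *m H^T = K *m V by rewrite mulmxK.
by rewrite 2!mulmxBl mul1mx -KS mulmxDr !mulmxA addrC addKr.
Qed.

(** The Woodbury identity, checked by multiplication: the gain formula turns the product into
    [(1 - K H) + K H]. *)
Lemma kalman_covariance_information :
  (1%:M - K *m H) *m P = invmx (invmx P + H^T *m invmx V *m H).
Proof.
have Pu := spd_unitmx sP.
suff /unitmx_mulmx1[] : (1%:M - K *m H) *m P *m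
    (invmx P + H^T *m invmx V *m H) = 1%:M by [].
by rewrite mulmxDr mulmxK // !mulmxA -kalman_gain_information subrK.
Qed.

End Information.
End SPD.

(** * Differential calculus on column vectors *)

Section ColumnVectors.
Context {R : realType}.

Lemma cV_norm_le n (x : 'cV[R]_n) (c : R) :
  0 <= c -> (forall i, `|x i 0| <= c) -> `|x| <= c.
Proof.
move=> c0 xc; rewrite [`|x|]mx_normrE; apply: bigmax_le => // -[i j] _ /=.
by rewrite ord1.
Qed.

Lemma mx_coord_norm_le m n (x : 'M[R]_(m, n)) i j : `|x i j| <= `|x|.
Proof.
rewrite [leRHS]mx_normrE.
exact: (@le_bigmax _ _ _ 0 (fun ij : 'I_m * 'I_n => `|x ij.1 ij.2|) (i, j)).
Qed.

(** The norm dual to the sup norm of column vectors, so that [|b . v| <= |b| l1 v]. *)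
Definition l1 {n} (x : 'cV[R]_n) : R := \sum_i `|x i 0|.

Lemma l1_ge0 n (x : 'cV[R]_n) : 0 <= l1 x.
Proof. by apply: sumr_ge0 => i _; exact: normr_ge0. Qed.

Lemma l1_le n (x : 'cV[R]_n) : l1 x <= n%:R * `|x|.
Proof.
apply: (@le_trans _ _ (\sum_(i < n) `|x|)).
  by apply: ler_sum => i _; exact: mx_coord_norm_le.
by rewrite sumr_const card_ord mulr_natl.
Qed.

Lemma coord_le_l1 n (x : 'cV[R]_n) i : `|x i 0| <= l1 x.
Proof.
by rewrite /l1 (bigD1 i) //= lerDl; apply: sumr_ge0 => j _; exact: normr_ge0.
Qed.

Lemma mulmx_bounded m n (A : 'M[R]_(m, n)) :
  exists2 C, 0 < C & forall v : 'cV[R]_n, `|A *m v| <= C * `|v|.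
Proof.
exists (\sum_i \sum_j `|A i j| + 1) => [|v].
  rewrite ltr_wpDl //; apply: sumr_ge0 => i _; apply: sumr_ge0 => j _.
  exact: normr_ge0.
apply: cV_norm_le => [|i].
  rewrite mulr_ge0 // addr_ge0 //; apply: sumr_ge0 => i _.
  by apply: sumr_ge0 => j _; exact: normr_ge0.
rewrite mxE; apply: le_trans (ler_norm_sum _ _ _) _.
apply: (@le_trans _ _ (\sum_j `|A i j| * `|v|)).
  apply: ler_sum => j _; rewrite normrM ler_wpM2l //; exact: mx_coord_norm_le.
rewrite -mulr_suml ler_wpM2r // (bigD1 i) //= -addrA lerDl addr_ge0 //.
by apply: sumr_ge0 => k _; apply: sumr_ge0 => j _; exact: normr_ge0.
Qed.

Lemma trmx_continuous m n : continuous (@trmx R m n).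
Proof.
apply: bounded_linear_continuous; apply/linear_boundedP.
near=> M => x; apply: (@le_trans _ _ (1 * `|x|)); last first.
  by rewrite ler_wpM2r //; near: M; exact: nbhs_pinfty_ge.
rewrite mul1r [leLHS]mx_normrE; apply: bigmax_le => // -[i j] _ /=.
by rewrite mxE; exact: mx_coord_norm_le.
Unshelve. all: by end_near. Qed.

(** Compactness is carried over from row vectors by transposition. *)
Lemma cV_bounded_closed_compact n (A : set 'cV[R]_n) :
  bounded_set A -> closed A -> compact A.
Proof.
move=> [M [Mr bA]] cA.
have -> : A = trmx @` [set x : 'rV[R]_n | A x^T].
  apply/seteqP; split => [x Ax|_ [x Ax <-//]].
  by exists x^T; rewrite /= trmxK.
apply: continuous_compact.
  by apply: continuous_subspaceT => x; exact: trmx_continuous.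
apply: bounded_closed_compact.
  exists `|M|; split=> // x /(le_lt_trans (ler_norm _)) Mx v /= /(bA _ Mx) h.
  apply: le_trans h; rewrite [leLHS]mx_normrE; apply: bigmax_le => // -[i j] _ /=.
  by apply: le_trans (mx_coord_norm_le _ _ _ j i); rewrite mxE.
rewrite -[X in closed X]/(@trmx R 1 n @^-1` A).
by apply: preimage_closed => // x _; exact: trmx_continuous.
Qed.

Lemma cV_EVT_min n (A : set 'cV[R]_n) (f : 'cV[R]_n -> R) :
  A !=set0 -> bounded_set A -> closed A ->
  (forall x, A x -> {for x, continuous f}) ->
  exists2 c, A c & forall x, A x -> f c <= f x.
Proof.
move=> A0 bA cA fc.
have cf : {within A, continuous f}.
  by apply: continuous_in_subspaceT => x; rewrite inE => /fc.
have [c] := compact_EVT_min A0 (cV_bounded_closed_compact _ _ bA cA) cf.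
rewrite inE => Ac cmin; exists c => // x Ax; apply: cmin; exact/mem_set.
Qed.

Lemma bounded_dist_le n (c : 'cV[R]_n) (r : R) (A : set 'cV[R]_n) :
  (forall x, A x -> `|x - c| <= r) -> bounded_set A.
Proof.
move=> Ar; exists (r + `|c|); split=> [|M rM x /Ar xr]; first exact: num_real.
apply/ltW/(le_lt_trans _ rM); rewrite -{1}[x](subrK c).
by rewrite (le_trans (ler_normD _ _)) // lerD2r.
Qed.

Lemma dist_continuous n (c : 'cV[R]_n) : continuous (fun x : 'cV[R]_n => `|x - c|).
Proof.
move=> x; apply: (continuous_comp (f := fun y : 'cV[R]_n => y - c)).
  by apply: continuousB; [move=> ?; exact: cvg_id|exact: cst_continuous].
exact: norm_continuous.
Qed.

Lemma closed_dist_le n (c : 'cV[R]_n) (r : R) :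
  closed [set x : 'cV[R]_n | `|x - c| <= r].
Proof.
apply: (@preimage_closed _ _ (fun x : 'cV[R]_n => `|x - c|) [set y | y <= r]).
  by move=> x _; exact: dist_continuous.
exact: closed_le.
Qed.

Lemma closed_dist_eq n (c : 'cV[R]_n) (r : R) :
  closed [set x : 'cV[R]_n | `|x - c| = r].
Proof.
apply: (@preimage_closed _ _ (fun x : 'cV[R]_n => `|x - c|) [set y | y = r]).
  by move=> x _; exact: dist_continuous.
exact: closed_eq.
Qed.

End ColumnVectors.

(** * Differentials from quadratic remainders, and Jacobians *)

Section Differentials.
Context {R : realType}.

(** A quadratic remainder is [o(|v|)], and the linear bound on [df] gives the continuity that a
    differential must have. *)
Lemma is_diff_remainder (V W : normedModType R) (f : V -> W)
    (df : {linear V -> W}) (x : V) (B C r : R) :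
  (forall v, `|df v| <= B * `|v|) -> 0 < r ->
  (forall v, `|v| < r -> `|f (v + x) - f x - df v| <= C * `|v| ^+ 2) ->
  is_diff x f df.
Proof.
move=> dfB r0 fC.
have dfc : continuous df.
  apply: bounded_linear_continuous; apply/linear_boundedP.
  exists B; split=> [|M /ltW BM v]; first exact: num_real.
  by apply: le_trans (dfB v) _; rewrite ler_wpM2r.
have ex : f \o shift x = cst (f x) + df +o_ 0 id.
  apply/eqaddoP => e e0.
  have C1 : 0 < `|C| + 1 by rewrite ltr_wpDl.
  near=> v; rewrite /= opprD addrA; apply: le_trans (fC v _) _.
    by near: v; apply: nbhs0_lt.
  rewrite expr2 mulrA ler_wpM2r //.
  apply: (@le_trans _ _ ((`|C| + 1) * `|v|)).
    by rewrite ler_wpM2r // (le_trans (ler_norm _)) // lerDl.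
  rewrite -ler_pdivlMl //; near: v; apply: nbhs0_le.
  by apply: mulr_gt0 => //; rewrite invr_gt0.
have dE := diff_unique dfc ex.
split => //; apply/diff_locallyP; rewrite dE; split => //.
Unshelve. all: by end_near. Qed.

Lemma diff_Jac n m (f : 'cV[R]_n -> 'cV[R]_m) x v :
  'd f x v = Jac f x *m v.
Proof.
have {1}-> : v = \sum_j v j 0 *: delta_mx j 0.
  by rewrite {1}[v]matrix_sum_delta; apply: eq_bigr => i _; rewrite big_ord1.
rewrite linear_sum; apply/colP => i; rewrite summxE mxE; apply: eq_bigr => j _.
by rewrite linearZ !mxE mulrC.
Qed.

Lemma mulmx_inj_cV m n (A B : 'M[R]_(m, n)) :
  (forall v : 'cV[R]_n, A *m v = B *m v) -> A = B.
Proof.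
by move=> AB; apply/trmx_inj/row_matrixP => i; rewrite -!tr_col !colE AB.
Qed.

(** The chain rule applied to [g \o f = id]. *)
Lemma Jac_inverse n (f g : 'cV[R]_n -> 'cV[R]_n) x :
  cancel f g -> differentiable f x -> differentiable g (f x) ->
  Jac g (f x) *m Jac f x = 1%:M.
Proof.
move=> fK df dg; apply: mulmx_inj_cV => v.
rewrite -mulmxA -!diff_Jac mul1mx.
have := diff_comp df dg; rewrite (_ : g \o f = id); last exact/funext/fK.
by move=> /(congr1 (fun h => h v)) /= <-; have [_ ->] := is_diff_id x.
Qed.

End Differentials.

(** * Laplace integrals *)

Section Dot.
Context {R : realType} {K : nat}.
Implicit Types b v w : 'cV[R]_K.

Definition dot b v : R := (b^T *m v) 0 0.

Lemma dotE b v : dot b v = \sum_k b k 0 * v k 0.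
Proof. by rewrite /dot mxE; apply: eq_bigr => k _; rewrite mxE. Qed.

Lemma dotDl b b' v : dot (b + b') v = dot b v + dot b' v.
Proof. by rewrite /dot linearD mulmxDl mxE. Qed.

Lemma dotNl b v : dot (- b) v = - dot b v.
Proof. by rewrite /dot linearN mulNmx mxE. Qed.

Lemma dotBl b b' v : dot (b - b') v = dot b v - dot b' v.
Proof. by rewrite dotDl dotNl. Qed.

Lemma dotDr b v w : dot b (v + w) = dot b v + dot b w.
Proof. by rewrite /dot mulmxDr mxE. Qed.

Lemma dotNr b v : dot b (- v) = - dot b v.
Proof. by rewrite /dot mulmxN mxE. Qed.

Lemma dotBr b v w : dot b (v - w) = dot b v - dot b w.
Proof. by rewrite dotDr dotNr. Qed.

Lemma dotC b v : dot b v = dot v b.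
Proof. by rewrite !dotE; apply: eq_bigr => k _; rewrite mulrC. Qed.

Lemma dot_le b v : `|dot b v| <= `|b| * l1 v.
Proof.
rewrite dotE /l1 mulr_sumr; apply: le_trans (ler_norm_sum _ _ _) _.
apply: ler_sum => k _; rewrite normrM ler_wpM2r //; exact: mx_coord_norm_le.
Qed.

(** The argument order makes [dotr w] a linear form, able to serve as a differential. *)
Definition dotr w v : R := dot v w.

Lemma dotr_linear w : linear (dotr w : 'cV[R]_K -> R^o).
Proof.
move=> a x y; rewrite /dotr /dot linearP mulmxDl -scalemxAl mxE; congr (_ + _).
by rewrite mxE.
Qed.

HB.instance Definition _ w :=
  GRing.isLinear.Build R 'cV[R]_K R^o *:%R (dotr w) (dotr_linear w).

End Dot.

(** * Inequalities for the exponential *)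

Section ExpBounds.
Context {R : realType}.

(** From [1 - x <= e^-x] follows [e^x - 1 - x <= x (e^x - 1)]; then [e^x - 1] is bounded above by
    [x e^x] if [x >= 0], and below by [x] if [x < 0]. *)
Lemma expR_taylor1 (x : R) : `|expR x - 1 - x| <= x ^+ 2 * expR `|x|.
Proof.
have h1 := expR_ge1Dx x; have h2 := expR_ge1Dx (- x).
rewrite ger0_norm; last lra.
have e0 := expR_gt0 x; have := expRxMexpNx_1 x => ee.
have h3 : expR x - 1 <= x * expR x by nra.
have [x0|x0] := leP 0 x; first by rewrite ger0_norm //; nra.
have : 1 <= expR `|x| by rewrite -expR0 ler_expR.
nra.
Qed.

(** Split [e^(s x)] into [p + 1] equal factors [e^(q x)] and use [1 + x <= (1 + 1/q) e^(q x)] for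
    each; [p + 1] instead of [p] covers [p = 0]. *)
Lemma poly_le_expR (s : R) (p : nat) : 0 < s ->
  exists2 c, 0 <= c & forall x, 0 <= x -> (1 + x) ^+ p <= c * expR (s * x).
Proof.
move=> s0; have p0 : 0 < p.+1%:R :> R by rewrite ltr0n.
have q0 : 0 < s / p.+1%:R by rewrite divr_gt0.
exists ((1 + (s / p.+1%:R)^-1) ^+ p.+1) => [|x x0].
  by rewrite exprn_ge0 // addr_ge0 // invr_ge0 ltW.
apply: (@le_trans _ _ ((1 + x) ^+ p.+1)).
  by rewrite exprS ler_peMl ?exprn_ge0 ?addr_ge0 // lerDl.
rewrite -[s in expR (s * x)](divfK (lt0r_neq0 p0)) mulrAC expRM_natr -exprMn.
rewrite lerXn2r ?nnegrE ?addr_ge0 // ?mulr_ge0 ?expR_ge0 //.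
  by rewrite addr_ge0 // invr_ge0 ltW.
set q := s / _ in q0 *; have := expR_ge1Dx (q * x).
have -> : (1 + q^-1) * expR (q * x) = expR (q * x) + q^-1 * expR (q * x) by ring.
move=> h; apply: lerD; first by apply: le_trans h; rewrite lerDl mulr_ge0 // ltW.
rewrite -ler_pdivrMl ?invr_gt0 // invrK; apply: le_trans h; rewrite lerDr //.
Qed.

(* Expanding the product of the [e^(s v_k) + e^(-s v_k)] bounds [e^(s |v|_1)] by
   exponentials of linear forms, which are integrable near an interior point. *)
Lemma expR_sum_norm_le (K : nat) (s : R) (v : 'cV[R]_K) :
  expR (`|s| * l1 v) <=
  \sum_(f : {ffun 'I_K -> bool}) expR (dot (\col_k ((-1) ^+ (f k) * s)) v).
Proof.
rewrite /l1 mulr_sumr expR_sum.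
apply: (@le_trans _ _ (\prod_k \sum_(e : bool) expR ((-1) ^+ e * s * v k 0))).
  apply: ler_prod => k _; rewrite expR_ge0 big_bool /= expr1 expr0 mul1r mulN1r.
  rewrite -normrM mulNr; have [h|h] := leP 0 (s * v k 0).
    by rewrite ger0_norm // lerDr expR_ge0.
  by rewrite ltr0_norm // lerDl expR_ge0.
rewrite bigA_distr_bigA /=; apply: ler_sum => f _; rewrite -expR_sum.
by rewrite dotE; under [in leRHS]eq_bigr do rewrite mxE.
Qed.

End ExpBounds.

(** * Integrals of real-valued functions *)

Section RealIntegrals.
Context {R : realType} {d : measure_display} {Y : measurableType d}.
Variable lam : {measure set Y -> \bar R}.
Implicit Types f g : Y -> R.

Definition Rintegrable f := lam.-integrable setT (EFin \o f).

Lemma Rintegrable_le f g : measurable_fun setT f ->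
  (forall y, `|f y| <= g y) -> Rintegrable g -> Rintegrable f.
Proof.
move=> mf fg; apply: le_integrable => //; first exact/measurable_EFinP.
by move=> y _ /=; rewrite lee_fin (le_trans (fg y)) // ler_norm.
Qed.

Lemma RintegrableZ (a : R) f : Rintegrable f -> Rintegrable (fun y => a * f y).
Proof. by move=> /(integrableZl measurableT a); apply: eq_integrable. Qed.

Lemma RintegrableB f g :
  Rintegrable f -> Rintegrable g -> Rintegrable (fun y => f y - g y).
Proof. by move=> fi gi; apply: eq_integrable (integrableB measurableT fi gi). Qed.

Lemma Rintegrable_sum (I : finType) (f : I -> Y -> R) :
  (forall i, Rintegrable (f i)) -> Rintegrable (fun y => \sum_i f i y).
Proof.
move=> fi; have h := integrable_sum measurableT (index_enum I)
  (P := xpredT) (fun i _ => fi i).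
by apply: eq_integrable h => // y _ /=; rewrite sumEFin.
Qed.

Lemma Rintegral_sum (I : finType) (f : I -> Y -> R) :
  (forall i, Rintegrable (f i)) ->
  \int[lam]_y (\sum_i f i y) = \sum_i \int[lam]_y (f i y).
Proof.
move=> fi; rewrite /Rintegral; under eq_integral do rewrite -sumEFin.
rewrite integral_sum //.
by rewrite -sum_fine // => i _; apply: integrable_fin_num => //; exact: fi.
Qed.

Lemma ge0_Rintegral_eq0 f : Rintegrable f -> (forall y, 0 <= f y) ->
  \int[lam]_y f y = 0 -> {ae lam, forall y, f y = 0}.
Proof.
move=> fi f0 f00.
have mf := measurable_int _ fi.
have /(ae_eq_integral_abs lam measurableT mf) :
    (\int[lam]_y `|(EFin \o f) y| = 0)%E.
  under eq_integral => y _ do rewrite /= ger0_norm //.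
  by rewrite -[LHS]fineK ?integrable_fin_num // [fine _]f00.
by apply: filterS => y /(_ I) [].
Qed.

End RealIntegrals.

(** * Functions of polynomial growth in the statistics *)

Section Tame.
Context {R : realType} {d : measure_display} {Y : measurableType d} {K : nat}.
Variable T : Y -> 'cV[R]_K.
Hypothesis mT : forall k, measurable_fun setT (fun y => T y k 0).
Implicit Types f g : Y -> R.

(** A class closed under sums and products whose members are integrable against every tilt
    [e^(b . T)] with [b] in [dom]. *)
Definition tame g := measurable_fun setT g /\
  exists p a, 0 <= a /\ forall y, `|g y| <= a * (1 + l1 (T y)) ^+ p.

Lemma ge1_1Dl1 y : 1 <= 1 + l1 (T y). Proof. by rewrite lerDl l1_ge0. Qed.

Lemma tame_cst (c : R) : tame (fun=> c).
Proof.
split; first exact: measurable_cst.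
by exists 0%N, `|c|; split=> // y; rewrite expr0 mulr1.
Qed.

Lemma tame_stat k : tame (fun y => T y k 0).
Proof.
split=> //; exists 1%N, 1; split=> // y; rewrite expr1 mul1r.
by rewrite (le_trans (coord_le_l1 _ _ k)) // lerDr.
Qed.

Lemma tameD f g : tame f -> tame g -> tame (fun y => f y + g y).
Proof.
move=> [mf [p [a [a0 fa]]]] [mg [q [b [b0 gb]]]]; split.
  exact: measurable_funD.
exists (p + q)%N, (a + b); split=> [|y]; first exact: addr_ge0.
rewrite mulrDl (le_trans (ler_normD _ _)) // lerD //.
  by rewrite (le_trans (fa y)) // ler_wpM2l // ler_weXn2l ?ge1_1Dl1 ?leq_addr.
by rewrite (le_trans (gb y)) // ler_wpM2l // ler_weXn2l ?ge1_1Dl1 ?leq_addl.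
Qed.

Lemma tameM f g : tame f -> tame g -> tame (fun y => f y * g y).
Proof.
move=> [mf [p [a [a0 fa]]]] [mg [q [b [b0 gb]]]]; split.
  exact: measurable_funM.
exists (p + q)%N, (a * b); split=> [|y]; first exact: mulr_ge0.
by rewrite normrM exprD mulrACA ler_pM.
Qed.

Lemma tameB f g : tame f -> tame g -> tame (fun y => f y - g y).
Proof.
move=> tf tg; have := tameD f _ tf (tameM _ _ (tame_cst (- 1)) tg).
by congr tame; apply/funext => y; rewrite mulN1r.
Qed.

Lemma tame_sum (I : finType) (f : I -> Y -> R) :
  (forall i, tame (f i)) -> tame (fun y => \sum_i f i y).
Proof.
move=> tf.
elim: (index_enum I) => [|i s IH].
  by under eq_fun do rewrite big_nil; exact: tame_cst.
by under eq_fun do rewrite big_cons; exact: tameD.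
Qed.

Lemma tame_dot b : tame (fun y => dot b (T y)).
Proof.
under eq_fun do rewrite dotE.
by apply: tame_sum => k; apply: tameM; [exact: tame_cst|exact: tame_stat].
Qed.

Lemma measurable_dot b : measurable_fun setT (fun y => dot b (T y)).
Proof. by have [] := tame_dot b. Qed.

Lemma measurable_l1 : measurable_fun setT (fun y => l1 (T y)).
Proof. by apply: measurable_sum => k; exact: measurableT_comp. Qed.

End Tame.

(** * Domain and second order expansion of Laplace integrals *)

Section Laplace.
Context {R : realType} {d : measure_display} {Y : measurableType d} {K : nat}.
Variables (lam : {measure set Y -> \bar R}) (T : Y -> 'cV[R]_K).
Hypothesis mT : forall k, measurable_fun setT (fun y => T y k 0).
Implicit Types (g : Y -> R) (b : 'cV[R]_K).

(** Unnormalized: [g = 1] gives the partition function, and expectations are quotients of two such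
    integrals. *)
Definition lint g b : R := \int[lam]_y (g y * expR (dot b (T y))).

(* This set is the interior of the natural parameter space: see
   [interior_natparam]. *)
Definition dom : set 'cV[R]_K := [set b | exists2 s, 0 < s &
  Rintegrable lam (fun y => expR (s * l1 (T y)) * expR (dot b (T y)))].

Lemma measurable_tilt g b : measurable_fun setT g ->
  measurable_fun setT (fun y => g y * expR (dot b (T y))).
Proof.
move=> mg; apply: measurable_funM => //; apply: measurableT_comp => //.
exact: measurable_dot.
Qed.

(** The margin factor [e^(s l1)] absorbs the polynomial growth of [g]. *)
Lemma dom_integrable g b : dom b -> tame T g ->
  Rintegrable lam (fun y => g y * expR (dot b (T y))).
Proof.
move=> [s s0 si] [mg [p [a [a0 ga]]]]; have [c c0 pc] := poly_le_expR s p s0.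
apply: (Rintegrable_le _ _ _ _ _ (RintegrableZ lam (a * c) _ si)).
  exact: measurable_tilt.
move=> y; rewrite normrM (ger0_norm (expR_ge0 _)) mulrA ler_wpM2r ?expR_ge0 //.
by rewrite (le_trans (ga y)) // -mulrA ler_wpM2l // pc // l1_ge0.
Qed.

Lemma lintD g g' b : dom b -> tame T g -> tame T g' ->
  lint (fun y => g y + g' y) b = lint g b + lint g' b.
Proof.
move=> bd tg tg'; rewrite /lint -RintegralD //; [|exact: dom_integrable..].
by congr Rintegral; apply/funext => y; rewrite mulrDl.
Qed.

Lemma lintB g g' b : dom b -> tame T g -> tame T g' ->
  lint (fun y => g y - g' y) b = lint g b - lint g' b.
Proof.
move=> bd tg tg'; rewrite /lint -RintegralB //; [|exact: dom_integrable..].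
by congr Rintegral; apply/funext => y; rewrite mulrBl.
Qed.

Lemma lintZ (a : R) g b : dom b -> tame T g ->
  lint (fun y => a * g y) b = a * lint g b.
Proof.
move=> bd tg; rewrite /lint -RintegralZl //; last exact: dom_integrable.
by congr Rintegral; apply/funext => y; rewrite mulrA.
Qed.

Lemma lint_sum (I : finType) (g : I -> Y -> R) b :
  dom b -> (forall i, tame T (g i)) ->
  lint (fun y => \sum_i g i y) b = \sum_i lint (g i) b.
Proof.
move=> bd tg; rewrite /lint -Rintegral_sum; last first.
  by move=> i; exact: dom_integrable.
by congr Rintegral; apply/funext => y; rewrite mulr_suml.
Qed.

Lemma lint_dot g b v : dom b -> tame T g ->
  lint (fun y => g y * dot v (T y)) b =
  dot v (\col_k lint (fun y => g y * T y k 0) b).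
Proof.
move=> bd tg.
have tk k : tame T (fun y => g y * T y k 0) by apply: tameM => //; exact: tame_stat.
transitivity (lint (fun y => \sum_k v k 0 * (g y * T y k 0)) b).
  congr lint; apply/funext => y; rewrite dotE mulr_sumr.
  by apply: eq_bigr => k _; rewrite mulrCA.
rewrite lint_sum //; last first.
  by move=> k; apply: tameM => //; exact: tame_cst.
by rewrite dotE; apply: eq_bigr => k _; rewrite mxE lintZ.
Qed.

(** Half of the margin [s] pays for moving [b], since [|(b' - b) . T| <= (s/2) l1 T]; the other half
    remains as margin. *)
Lemma dom_open b : dom b ->
  exists2 r, 0 < r & forall b', `|b' - b| < r -> dom b'.
Proof.
move=> [s s0 si]; exists (s / 2) => [|b' b'b]; first by rewrite divr_gt0.
exists (s / 2); first by rewrite divr_gt0.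
apply: Rintegrable_le si.
  apply: measurable_tilt; apply: measurableT_comp => //.
  by apply: measurable_funM => //; exact: measurable_l1.
move=> y; rewrite ger0_norm ?mulr_ge0 ?expR_ge0 // -!expRD ler_expR.
have := dot_le (b' - b) (T y); rewrite dotBl => h.
have {}h : dot b' (T y) - dot b (T y) <= s / 2 * l1 (T y).
  apply: le_trans (ler_norm _) _; apply: le_trans h _.
  by rewrite ler_wpM2r ?l1_ge0 // ltW.
lra.
Qed.

(** [e^((r/2) l1)] is dominated by a sum over the vectors with entries [r/2] or [-r/2], and each
    such shift keeps [b] in the ball. *)
Lemma dom_of_ball b r : 0 < r ->
  (forall b', `|b' - b| < r -> Rintegrable lam (fun y => expR (dot b' (T y)))) ->
  dom b.
Proof.
move=> r0 bi; exists (r / 2); first by rewrite divr_gt0.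
pose sgn (f : {ffun 'I_K -> bool}) : 'cV[R]_K := \col_k ((-1) ^+ (f k) * (r / 2)).
apply: (Rintegrable_le _ _ (fun y => \sum_f expR (dot (sgn f + b) (T y)))).
- apply: measurable_tilt; apply: measurableT_comp => //.
  by apply: measurable_funM => //; exact: measurable_l1.
- move=> y; rewrite ger0_norm ?mulr_ge0 ?expR_ge0 //.
  under eq_bigr do rewrite dotDl expRD.
  rewrite -mulr_suml ler_wpM2r ?expR_ge0 //.
  by have := expR_sum_norm_le K (r / 2) (T y); rewrite ger0_norm // divr_ge0 // ltW.
apply: Rintegrable_sum => f; apply: bi; rewrite addrK.
have r20 : 0 <= r / 2 by rewrite divr_ge0 // ltW.
apply: (@le_lt_trans _ _ (r / 2)); last by lra.
by apply: cV_norm_le => // k; rewrite mxE normrM normrX normrN1 expr1n mul1r ger0_norm.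
Qed.

Lemma expfam_Z_lty b : (expfam_Z lam T b < +oo)%E <->
  Rintegrable lam (fun y => expR (dot b (T y))).
Proof.
have me : measurable_fun setT (EFin \o (fun y => expR (dot b (T y)))).
  apply/measurable_EFinP; apply: measurableT_comp => //; exact: measurable_dot.
have E : (\int[lam]_y `|(EFin \o (fun y => expR (dot b (T y)))) y|)%E =
    expfam_Z lam T b.
  by apply: eq_integral => y _ /=; rewrite ger0_norm // expR_ge0.
split=> [h|/integrableP[_]]; last by rewrite E.
by apply/integrableP; split=> //; rewrite E.
Qed.

Lemma dom_expR b : dom b -> Rintegrable lam (fun y => expR (dot b (T y))).
Proof.
move=> /(dom_integrable (fun=> 1)) /(_ (tame_cst _ _)).
by under eq_fun do rewrite mul1r.
Qed.

Lemma interior_natparam b : interior (expfam_natparam lam T) b <-> dom b.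
Proof.
split=> [/nbhs_ballP[r /= r0 br]|/dom_open[r r0 rb]].
  apply: (dom_of_ball _ r r0) => b' b'b; apply/expfam_Z_lty/br.
  by rewrite -ball_normE /= distrC.
apply/nbhs_ballP; exists r => //= b'; rewrite -ball_normE /= distrC => b'b.
exact/expfam_Z_lty/dom_expR/rb.
Qed.

(** Integrate the bound on [e^x - 1 - x] at [x = v . T(y)] against the tilt. The constants depend on
    [b] only, uniformly over [g] of linear growth, which covers both [1] and the coordinates of
    [T - c]. *)
Lemma lint_taylor b : dom b -> exists C r, [/\ 0 <= C, 0 < r &
  forall g (a : R) v, measurable_fun setT g -> 0 <= a ->
    (forall y, `|g y| <= a * (1 + l1 (T y))) -> `|v| < r ->
    `|lint g (v + b) - lint g b - dot v (\col_k lint (fun y => g y * T y k 0) b)|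
      <= a * C * `|v| ^+ 2].
Proof.
move=> bd; have [r1 r10 rd] := dom_open _ bd; have [s s0 si] := bd.
(* The exponent 3 collects one factor [1 + l1 T] from [g] and two from [x^2]; the other half of [s]
   is kept for [e^|x|]. *)
have [c c0 pc] := poly_le_expR (s / 2) 3 ltac:(by rewrite divr_gt0).
set W := fun y => _ in si.
exists (c * \int[lam]_y W y), (Num.min r1 (s / 2)); split.
- by rewrite mulr_ge0 // Rintegral_ge0 // => y _; rewrite /W mulr_ge0 ?expR_ge0.
- by rewrite lt_min r10 divr_gt0.
move=> g a v mg a0 ga; rewrite lt_min => /andP[vr vs].
have tg : tame T g by split=> //; exists 1%N, a; split=> // y; rewrite expr1.
have td : tame T (fun y => g y * dot v (T y)).
  by apply: tameM => //; exact: tame_dot.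
have bvd : dom (v + b) by apply: rd; rewrite addrK.
rewrite -lint_dot // /lint -RintegralB //; [|exact: dom_integrable..].
rewrite -RintegralB //; [|apply: RintegrableB|]; [|exact: dom_integrable..].
have i3 : Rintegrable lam (fun y => g y * expR (dot (v + b) (T y)) -
    g y * expR (dot b (T y)) - g y * dot v (T y) * expR (dot b (T y))).
  by apply: RintegrableB; [apply: RintegrableB|]; exact: dom_integrable.
apply: le_trans (le_normr_Rintegral _ i3) _ => //.
rewrite mulrAC mulrA -RintegralZl //; apply: le_Rintegral => //.
- exact: integrable_norm.
- exact: RintegrableZ.
move=> y _; rewrite dotDl expRD.
set x := dot v (T y); set w := expR (dot b (T y)); set m := l1 (T y).
have -> : g y * (expR x * w) - g y * w - g y * x * w =
  g y * (expR x - 1 - x) * w by ring.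
have w0 : 0 < w by exact: expR_gt0.
have m0 : 0 <= m by exact: l1_ge0.
rewrite 2!normrM (gtr0_norm w0) /W mulrA ler_wpM2r ?(ltW w0) // -/m.
have xm : `|x| <= `|v| * m by exact: dot_le.
have h2 : `|expR x - 1 - x| <= (`|v| * (1 + m)) ^+ 2 * expR (s / 2 * m).
  apply: le_trans (expR_taylor1 x) _; apply: ler_pM; rewrite ?sqr_ge0 ?expR_ge0 //.
    rewrite -real_normK ?num_real // lerXn2r ?nnegrE ?mulr_ge0 ?addr_ge0 //.
    by rewrite (le_trans xm) // ler_wpM2l // lerDr.
  by rewrite ler_expR (le_trans xm) // ler_wpM2r // ltW.
have h3 : (1 + m) ^+ 3 * expR (s / 2 * m) <= c * expR (s * m).
  have -> : s * m = s / 2 * m + s / 2 * m by field.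
  by rewrite expRD mulrA ler_wpM2r ?expR_ge0 // pc.
apply: (@le_trans _ _ (a * (1 + m) * ((`|v| * (1 + m)) ^+ 2 * expR (s / 2 * m)))).
  by apply: ler_pM.
have -> : a * (1 + m) * ((`|v| * (1 + m)) ^+ 2 * expR (s / 2 * m)) =
  a * `|v| ^+ 2 * ((1 + m) ^+ 3 * expR (s / 2 * m)) by ring.
by rewrite -[leRHS]mulrA ler_wpM2l // mulr_ge0 ?sqr_ge0.
Qed.

End Laplace.

(** * Differential and minimizers of the partition function *)

Section LaplaceCalculus.
Context {R : realType} {d : measure_display} {Y : measurableType d} {K : nat}.
Variables (lam : {measure set Y -> \bar R}) (T : Y -> 'cV[R]_K).
Hypothesis mT : forall k, measurable_fun setT (fun y => T y k 0).
Implicit Types (g : Y -> R) (b : 'cV[R]_K).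

Lemma one_le_1Dl1 y : `|1 : R| <= 1 * (1 + l1 (T y)).
Proof. by rewrite normr1 mul1r lerDl l1_ge0. Qed.

Lemma is_diff_lint g (a : R) b : dom lam T b -> measurable_fun setT g -> 0 <= a ->
  (forall y, `|g y| <= a * (1 + l1 (T y))) ->
  is_diff b (lint lam T g) (dotr (\col_k lint lam T (fun y => g y * T y k 0) b)).
Proof.
move=> bd mg a0 ga; have [C [r [C0 r0 h]]] := lint_taylor lam T mT b bd.
set w := \col_k _.
apply: (@is_diff_remainder _ _ R^o _ (dotr w) _ (l1 w) (a * C) r) => // v.
  by rewrite /dotr mulrC; exact: dot_le.
by move=> vr; exact: h.
Qed.

Lemma is_diff_lint1 b : dom lam T b -> is_diff b (lint lam T (fun=> 1))
  (dotr (\col_k lint lam T (fun y => T y k 0) b)).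
Proof.
move=> bd; have := is_diff_lint _ 1 _ bd (measurable_cst _) ler01 one_le_1Dl1.
by congr (is_diff _ _ (dotr _)); apply/colP => k; rewrite !mxE; congr lint;
  apply/funext => y; rewrite mul1r.
Qed.

(** A nonzero moment [m] would allow a step [-t m] along coordinate [k], whose linear gain [t m^2]
    beats the error [C t^2 m^2] once [t C < 1]. *)
Lemma lint1_stationary b r : dom lam T b -> 0 < r ->
  (forall v, `|v| < r -> lint lam T (fun=> 1) b <= lint lam T (fun=> 1) (v + b)) ->
  forall k, lint lam T (fun y => T y k 0) b = 0.
Proof.
move=> bd r0 bmin k; have [C [r' [C0 r'0 h]]] := lint_taylor lam T mT b bd.
set m := lint _ _ _ _; apply/eqP/negPn/negP => m0.
have nm0 : 0 < `|m| by rewrite normr_gt0.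
have C1 : 0 < C + 1 by rewrite ltr_wpDl.
(* [C + 1] replaces [C], which may vanish; [t |m|] must fit both the minimality radius and the
   Taylor radius. *)
have [t [t0 tr tC]] : exists t, [/\ 0 < t, t * `|m| < Num.min r r' & t * (C + 1) < 1].
  have rr0 : 0 < Num.min r r' by rewrite lt_min r0.
  exists (Num.min (Num.min r r' / 2 / `|m|) ((C + 1)^-1 / 2)); split.
  - by rewrite lt_min !divr_gt0 // invr_gt0.
  - apply: (@le_lt_trans _ _ (Num.min r r' / 2)).
      by rewrite -ler_pdivlMr // ge_min lexx.
    by rewrite ltr_pdivrMr // ltr_pMr ?ltr1n.
  - apply: (@le_lt_trans _ _ (1 / 2)); last by rewrite ltr_pdivrMr ?mul1r ?ltr1n.
    by rewrite -ler_pdivlMr // div1r [2^-1 / _]mulrC ge_min lexx orbT.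
pose v : 'cV[R]_K := (- (t * m)) *: delta_mx k 0.
have vn : `|v| <= t * `|m|.
  apply: cV_norm_le => [|i]; first by rewrite mulr_ge0 // ltW.
  rewrite !mxE normrM normrN normrM (gtr0_norm t0).
  by case: (_ && _); rewrite /= ?normr1 ?mulr1 // normr0 mulr0 mulr_ge0 // ltW.
have vr : `|v| < Num.min r r' by exact: le_lt_trans tr.
move: vr; rewrite lt_min => /andP[vr vr'].
have := h (fun=> 1) 1 v (measurable_cst _) ler01 one_le_1Dl1 vr'.
have -> : dot v (\col_k0 lint lam T (fun y => 1 * T y k0 0) b) = - (t * m ^+ 2).
  rewrite dotE (bigD1 k) //= big1 => [|i ik].
    rewrite !mxE !eqxx addr0 mulr1 mulNr expr2 mulrA; congr (- (_ * _)).
    by congr lint; apply/funext => y; rewrite mul1r.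
  by rewrite !mxE (negbTE ik) mulr0 mul0r.
move=> /(le_trans (ler_norm _)) h1; have h2 := bmin v vr.
clear h bmin.
have v2 : `|v| ^+ 2 <= t ^+ 2 * m ^+ 2.
  rewrite -exprMn -[leRHS]real_normK ?num_real // lerXn2r ?nnegrE //.
  by rewrite normrM (gtr0_norm t0).
have m2 : 0 < m ^+ 2 by rewrite exprn_even_gt0.
have : t * m ^+ 2 <= C * (t ^+ 2 * m ^+ 2).
  apply: (@le_trans _ _ (C * `|v| ^+ 2)); last by rewrite ler_wpM2l.
  rewrite -[leLHS]add0r -[C]mul1r; apply: le_trans h1.
  by rewrite opprK lerD2r subr_ge0.
have -> : C * (t ^+ 2 * m ^+ 2) = (t * m ^+ 2) * (t * C) by ring.
have tm : 0 < t * m ^+ 2 by rewrite mulr_gt0.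
rewrite -ler_pdivrMl // mulVf ?gt_eqF // leNgt => /negP; apply.
by apply: le_lt_trans tC; rewrite ler_wpM2l ?lerDl // ltW.
Qed.

Hypothesis minT : forall (c : 'cV[R]_K) (c0 : R),
  {ae lam, forall y, dot c (T y) = c0} -> c = 0.

(** If the integral vanished, the positive integrand would be zero almost everywhere, so any
    property would hold almost everywhere; minimality applied to a basis vector, which exists as
    [0 < K], is then contradicted. *)
Lemma lint1_gt0 b : (0 < K)%N -> dom lam T b -> 0 < lint lam T (fun=> 1) b.
Proof.
move=> K0 bd; rewrite lt_neqAle eq_sym Rintegral_ge0 ?andbT => [|y _]; last first.
  by rewrite mulr_ge0 ?expR_ge0.
apply/eqP => /(ge0_Rintegral_eq0 _ _ (dom_integrable _ _ mT _ _ bd (tame_cst T 1))).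
move=> h; have {h}/minT : {ae lam, forall y,
    dot (delta_mx (Ordinal K0) 0 : 'cV[R]_K) (T y) = 0}.
  apply: filterS (h _) => y; rewrite ?mul1r ?expR_ge0 //.
  by move/eqP; rewrite expR_eq0.
move/colP => /(_ (Ordinal K0)); rewrite !mxE !eqxx => /eqP.
by rewrite oner_eq0.
Qed.

(** Strict convexity: the gap between the exponential and its tangent at [b0] is nonnegative, and
    its integral is the difference of the two values by stationarity. Equality forces
    [(b - b0) . T = 0] almost everywhere. *)
Lemma lint1_strict_min b0 b : dom lam T b0 -> dom lam T b ->
  (forall k, lint lam T (fun y => T y k 0) b0 = 0) -> b != b0 ->
  lint lam T (fun=> 1) b0 < lint lam T (fun=> 1) b.
Proof.
move=> b0d bd st bb0.
pose f y := 1 * expR (dot b (T y)) - (1 + dot (b - b0) (T y)) * expR (dot b0 (T y)).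
have t1 : tame T (fun=> 1) := tame_cst T 1.
have td : tame T (fun y => 1 + dot (b - b0) (T y)).
  by apply: tameD => //; exact: tame_dot.
have fi : Rintegrable lam f by apply: RintegrableB; exact: dom_integrable.
have fE y : f y = (expR (dot (b - b0) (T y)) - 1 - dot (b - b0) (T y)) *
    expR (dot b0 (T y)).
  rewrite /f; have -> : dot b (T y) = dot (b - b0) (T y) + dot b0 (T y).
    by rewrite dotBl subrK.
  by rewrite expRD; ring.
have f0 y : 0 <= f y.
  rewrite fE mulr_ge0 ?expR_ge0 //.
  by rewrite -addrA -opprD subr_ge0 expR_ge1Dx.
have intf : \int[lam]_y f y = lint lam T (fun=> 1) b - lint lam T (fun=> 1) b0.
  rewrite RintegralB //; [|exact: dom_integrable..].
  congr (_ - _); rewrite -[LHS]/(lint lam T _ b0) lintD //; last exact: tame_dot.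
  have -> : lint lam T (fun y => dot (b - b0) (T y)) b0 = 0.
    have := lint_dot lam T mT (fun=> 1) b0 (b - b0) b0d t1.
    under [X in lint _ _ X]eq_fun do rewrite mul1r.
    move=> ->; rewrite dotE big1 // => k _; rewrite mxE.
    under [X in lint _ _ X]eq_fun do rewrite mul1r.
    by rewrite st mulr0.
  by rewrite addr0.
have : 0 <= \int[lam]_y f y by apply: Rintegral_ge0.
rewrite intf subr_ge0 lt_neqAle => ->; rewrite andbT.
apply: contra bb0 => /eqP ZZ.
have /(ge0_Rintegral_eq0 _ _ fi f0) f00 : \int[lam]_y f y = 0.
  by rewrite intf ZZ subrr.
rewrite -subr_eq0; apply/eqP/(minT _ 0); apply: filterS f00 => y.
rewrite fE => /eqP; rewrite mulf_eq0 expR_eq0 orbF => /eqP h.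
by apply/eqP/negPn/negP => /expR_gt1Dx; rewrite -subr_gt0 opprD addrA h ltxx.
Qed.

End LaplaceCalculus.

(** * Statistics centred at a prescribed mean *)

Section Shift.
Context {R : realType} {d : measure_display} {Y : measurableType d} {K : nat}.
Variables (lam : {measure set Y -> \bar R}) (T : Y -> 'cV[R]_K).
Hypothesis mT : forall k, measurable_fun setT (fun y => T y k 0).

(** Centring at [c] turns the equation for mean [c] into stationarity of
    [b |-> int exp(b . (T - c))]. *)
Definition shift_stat (c : 'cV[R]_K) : Y -> 'cV[R]_K := fun y => T y - c.

Lemma measurable_shift_stat c k : measurable_fun setT (fun y => shift_stat c y k 0).
Proof.
under eq_fun do rewrite /shift_stat !mxE.
by apply: measurable_funB => //; exact: measurable_cst.
Qed.

Lemma shift_stat_minimal c :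
  (forall (v : 'cV[R]_K) (v0 : R), {ae lam, forall y, dot v (T y) = v0} -> v = 0) ->
  forall (v : 'cV[R]_K) (v0 : R),
    {ae lam, forall y, dot v (shift_stat c y) = v0} -> v = 0.
Proof.
move=> minT v v0 h; apply: (minT v (v0 + dot v c)); apply: filterS h => y.
by rewrite /shift_stat dotBr => <-; rewrite subrK.
Qed.

(** Centring changes the integrand by at most the constant factor [e^(s l1 c - b . c)]. *)
Lemma shift_stat_dom c b : dom lam T b -> dom lam (shift_stat c) b.
Proof.
move=> [s s0 si]; exists s => //.
apply: (Rintegrable_le _ _ _ _ _
  (RintegrableZ lam (expR (s * l1 c - dot b c)) _ si)).
  have mS := measurable_shift_stat c.
  apply: measurable_funM; apply: measurableT_comp => //.
    by apply: measurable_funM => //; exact: measurable_l1.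
  exact: measurable_dot.
move=> y; rewrite ger0_norm ?mulr_ge0 ?expR_ge0 // -!expRD ler_expR.
have h : l1 (shift_stat c y) <= l1 (T y) + l1 c.
  rewrite /l1 -big_split; apply: ler_sum => k _; rewrite !mxE.
  exact: ler_normB.
rewrite dotBr -subr_ge0 [X in 0 <= X](_ : _ =
  s * (l1 (T y) + l1 c - l1 (shift_stat c y))); last by ring.
by rewrite mulr_ge0 ?subr_ge0 // ltW.
Qed.

Lemma shift_stat_lint c b g : dom lam T b -> tame T g ->
  lint lam (shift_stat c) g b = expR (- dot b c) * lint lam T g b.
Proof.
move=> bd tg; rewrite /lint -RintegralZl //; last exact: dom_integrable.
congr Rintegral; apply/funext => y; rewrite /shift_stat dotBr expRD.
by rewrite mulrA [RHS]mulrC.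
Qed.

Lemma shift_stat_coord_tame c k : tame T (fun y => shift_stat c y k 0).
Proof.
under eq_fun do rewrite /shift_stat !mxE.
by apply: tameB; [exact: tame_stat|exact: tame_cst].
Qed.

Lemma shift_stat_lint_eq0 c b g : dom lam T b -> tame T g ->
  (lint lam (shift_stat c) g b = 0) <-> (lint lam T g b = 0).
Proof.
move=> bd tg; rewrite shift_stat_lint //; split=> [/eqP|->]; last by rewrite mulr0.
by rewrite mulf_eq0 expR_eq0 => /eqP.
Qed.

End Shift.

(** Used with [zb] the value at the centre of a ball, [zs] the minimum on its sphere, [zx] a value
    there and [e] the displacement of the mean; it rests on [e^-w >= 1 - w >= 1 - k e]. *)
Lemma expR_perturb_gt {R : realType} (zb zs zx k e w : R) :
  0 < zs -> zs <= zx -> 0 <= e -> e * (zs * (k + 1)) < zs - zb ->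
  `|w| <= k * e -> zb < expR (- w) * zx.
Proof.
move=> zs0 sx e0 h wk; apply: (@lt_le_trans _ _ (expR (- w) * zs)); last first.
  by rewrite ler_wpM2l ?expR_ge0.
apply: (@lt_le_trans _ _ ((1 - k * e) * zs)).
  by have : 0 <= e * zs; [rewrite mulr_ge0 // ltW|nra].
rewrite ler_wpM2r ?(ltW zs0) //; apply: le_trans (expR_ge1Dx _).
by rewrite lerD2l lerN2 (le_trans (ler_norm _)).
Qed.

(** * Solving the mean equation *)

Section MeanMap.
Context {R : realType} {d : measure_display} {Y : measurableType d} {K : nat}.
Variables (lam : {measure set Y -> \bar R}) (T : Y -> 'cV[R]_K).
Hypothesis mT : forall k, measurable_fun setT (fun y => T y k 0).
Hypothesis minT : forall (c : 'cV[R]_K) (c0 : R),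
  {ae lam, forall y, dot c (T y) = c0} -> c = 0.

(* [b] is the natural parameter of mean [c]; unlike [expfam_mean b = c], this
   form involves no division by the partition function. *)
Definition mean_eq c b := forall k, lint lam T (fun y => shift_stat T c y k 0) b = 0.

(* Each of two solutions would be the strict minimizer of the same function. *)
Lemma mean_eq_inj c b b' : dom lam T b -> dom lam T b' ->
  mean_eq c b -> mean_eq c b' -> b = b'.
Proof.
have H x x' : dom lam T x -> dom lam T x' -> mean_eq c x -> x' != x ->
    lint lam (shift_stat T c) (fun=> 1) x < lint lam (shift_stat T c) (fun=> 1) x'.
  move=> xd x'd xc; apply: lint1_strict_min.
  - exact: measurable_shift_stat.
  - exact: shift_stat_minimal.
  - exact: shift_stat_dom.
  - exact: shift_stat_dom.
  - move=> k; apply/shift_stat_lint_eq0 => //; exact: shift_stat_coord_tame.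
move=> bd b'd bc b'c; apply/eqP/negPn/negP => bb'.
have := H _ _ bd b'd bc; rewrite eq_sym => /(_ bb').
by move/lt_trans/(_ (H _ _ b'd bd b'c bb')); rewrite ltxx.
Qed.

(* The minimum of [b' |-> int exp (b' . (T y - c'))] over the ball of radius [r] is
   interior because, for [c' = c], the value at the centre lies strictly below the
   minimum over the sphere, and this gap survives a small change of [c']. *)
Lemma mean_eq_local_exists c b (r : R) : (0 < K)%N -> dom lam T b -> mean_eq c b ->
  0 < r -> exists2 rho, 0 < rho & forall c', `|c' - c| < rho ->
    exists2 b', dom lam T b' & `|b' - b| < r /\ mean_eq c' b'.
Proof.
move=> K0 bd bc r0; have [r1 r10 rd] := dom_open lam T mT b bd.
(* Shrinking [r] below [r1] puts the whole closed ball inside [dom]. *)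
wlog rr1 : r r0 / r < r1.
  move=> H; have [] := H (Num.min r (r1 / 2)).
  - by rewrite lt_min r0 divr_gt0.
  - by rewrite gt_min [X in _ || X]ltr_pdivrMr // ltr_pMr // ltr1n orbT.
  move=> rho rho0 h; exists rho => // c' /h [b' b'd [+ ?]].
  by rewrite lt_min => /andP[? _]; exists b'.
have ballD b' : `|b' - b| <= r -> dom lam T b'.
  by move=> h; apply: rd; exact: le_lt_trans rr1.
pose G c' := lint lam (shift_stat T c') (fun=> 1).
have Gcont c' b' : `|b' - b| <= r -> {for b', continuous (G c')}.
  move=> /ballD b'd; apply: differentiable_continuous.
  have := is_diff_lint1 lam _ (measurable_shift_stat T mT c') b'
    (shift_stat_dom lam T mT c' b' b'd).
  by case.
have t1 : tame T (fun=> 1) := tame_cst T 1.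
pose S := [set x : 'cV[R]_K | `|x - b| = r].
have SB x : S x -> `|x - b| <= r by move=> ->.
have S0 : S !=set0.
  exists (b + const_mx r); rewrite /S /= addrAC subrr add0r.
  apply/eqP; rewrite eq_le; apply/andP; split.
    by apply: cV_norm_le => [|i]; [exact: ltW|rewrite mxE gtr0_norm].
  have := mx_coord_norm_le _ _ (const_mx r : 'cV[R]_K) (Ordinal K0) 0.
  by rewrite mxE gtr0_norm.
have [s Ss smin] := cV_EVT_min _ _ _ S0 (bounded_dist_le _ _ _ _ SB)
  (closed_dist_eq _ _ _) (fun x Sx => Gcont c x (SB x Sx)).
have gap : G c b < G c s.
  apply: lint1_strict_min.
  - exact: measurable_shift_stat.
  - exact: shift_stat_minimal.
  - exact: shift_stat_dom.
  - by apply: shift_stat_dom => //; apply/ballD/SB.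
  - move=> k; apply/shift_stat_lint_eq0 => //; exact: shift_stat_coord_tame.
  - by apply: contraTneq r0 => sb; rewrite -Ss sb subrr normr0 ltxx.
have Gb0 : 0 < G c b.
  apply: lint1_gt0 => //; first exact: measurable_shift_stat.
    exact: shift_stat_minimal.
  exact: shift_stat_dom.
have Gs0 : 0 < G c s := lt_trans Gb0 gap.
have q0 : 0 < r * K%:R + 1 by rewrite ltr_wpDl // mulr_ge0 // ltW.
(* The radius demanded by [expR_perturb_gt] with [k = r K], because
   [|(x - b) . (c' - c)| <= r K |c' - c|] on the sphere. *)
exists ((G c s - G c b) / (G c s * (r * K%:R + 1))).
  by apply: divr_gt0; [rewrite subr_gt0; exact: gap|exact: mulr_gt0].
have Gq0 : 0 < G c s * (r * K%:R + 1) by exact: mulr_gt0.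
move=> c'; rewrite (ltr_pdivlMr _ _ Gq0) => c'c.
(* Passing from [c] to [c'] multiplies by [e^(-x . (c' - c))]; the factor at [b] is common to all
   [x] and cancels in comparisons. *)
have GE x : `|x - b| <= r ->
    G c' x = expR (- dot (x - b) (c' - c)) * expR (- dot b (c' - c)) * G c x.
  move=> /ballD xd; rewrite /G !shift_stat_lint // mulrA -!expRD.
  by congr (expR _ * _); rewrite !dotBl !dotBr; ring.
have bB : `|b - b| <= r by rewrite subrr normr0 ltW.
have sphere x : S x -> G c' b < G c' x.
  move=> Sx; rewrite (GE _ (SB x Sx)) (GE _ bB) subrr.
  rewrite [dot 0 _](_ : _ = 0) ?oppr0 ?expR0 ?mul1r; last first.
    by rewrite /dot trmx0 mul0mx mxE.
  rewrite mulrAC [ltRHS]mulrC ltr_pM2l ?expR_gt0 //.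
  apply: (expR_perturb_gt _ _ _ (r * K%:R) _ _ Gs0 (smin _ Sx) _ c'c) => //.
  apply: le_trans (dot_le _ _) _.
  by rewrite Sx -mulrA ler_wpM2l ?(ltW r0) // l1_le.
pose B := [set x : 'cV[R]_K | `|x - b| <= r].
have B0 : B !=set0 by exists b.
have [b' Bb' b'min] := cV_EVT_min _ _ _ B0
  (bounded_dist_le _ b r _ (fun x (Bx : B x) => Bx))
  (closed_dist_le _ _ _) (fun x Bx => Gcont c' x Bx).
have b'r : `|b' - b| < r.
  rewrite lt_neqAle (Bb' : `|b' - b| <= r) andbT; apply/eqP => Sb'.
  by have := lt_le_trans (sphere _ Sb') (b'min _ bB); rewrite ltxx.
have b'd := ballD _ (Bb' : `|b' - b| <= r).
exists b'; first exact: b'd.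
have stat k : lint lam (shift_stat T c') (fun y => shift_stat T c' y k 0) b' = 0.
  (* The distance left to the sphere is a radius on which [b'] is an unconstrained minimizer. *)
  have d0 : 0 < r - `|b' - b| by rewrite subr_gt0; exact: b'r.
  apply: (lint1_stationary _ _ (measurable_shift_stat T mT c') _ _ _ d0).
    exact: shift_stat_dom.
  move=> v; rewrite ltrBrDr => vr; apply: b'min; rewrite /B /= -addrA.
  exact: le_trans (ler_normD _ _) (ltW vr).
split; first exact: b'r.
move=> k; have tk := shift_stat_coord_tame T mT c' k.
exact: (iffLR (shift_stat_lint_eq0 lam T mT c' b' _ b'd tk) (stat k)).
Qed.

End MeanMap.

(** * Exponential families in mean parametrization *)

Section ExponentialFamily.
Context {R : realType} {d : measure_display} {Y : measurableType d} {K : nat}.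
Variables (lam : {measure set Y -> \bar R}) (T : Y -> 'cV[R]_K).
Hypothesis minT : expfam_minimal lam T.
Hypothesis K0 : (0 < K)%N.

Let mT : forall k, measurable_fun setT (fun y => T y k 0). Proof. by case: minT. Qed.

Let linT (c : 'cV[R]_K) (c0 : R) : {ae lam, forall y, dot c (T y) = c0} -> c = 0.
Proof. by case: minT => _; apply. Qed.

Let t1 : tame T (fun=> 1) := tame_cst T 1.

Let stat_tame c k : tame T (fun y => shift_stat T c y k 0).
Proof. exact: shift_stat_coord_tame. Qed.

Lemma expfam_ZE b : fine (expfam_Z lam T b) = lint lam T (fun=> 1) b.
Proof.
by congr fine; apply: eq_integral => y _; rewrite mul1r.
Qed.

Lemma expfam_expectation g b : dom lam T b -> tame T g ->
  \int[lam]_y (g y * expfam_dens lam T b y) =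
  lint lam T g b / lint lam T (fun=> 1) b.
Proof.
move=> bd tg; rewrite -expfam_ZE /lint -RintegralZr //; last exact: dom_integrable.
by congr Rintegral; apply/funext => y; rewrite -mulrA.
Qed.

Lemma mean_eqE c b : dom lam T b -> mean_eq lam T c b <->
  forall k, lint lam T (fun y => T y k 0) b = c k 0 * lint lam T (fun=> 1) b.
Proof.
move=> bd.
have E k : lint lam T (fun y => shift_stat T c y k 0) b =
    lint lam T (fun y => T y k 0) b - c k 0 * lint lam T (fun=> 1) b.
  rewrite -lintZ // -lintB //; first last.
  - by apply: tameM => //; exact: tame_cst.
  - exact: tame_stat.
  by congr lint; apply/funext => y; rewrite /shift_stat !mxE mulr1.
split=> h k; last by rewrite E h subrr.
by move: (h k); rewrite E => /eqP; rewrite subr_eq0 => /eqP.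
Qed.

(** For [0 < K] the partition function is positive, so the normalized mean equation can be cleared
    of its denominator. *)
Lemma expfam_valid_natE c b :
  expfam_valid_nat lam T c b <-> dom lam T b /\ mean_eq lam T c b.
Proof.
have meanE (bd : dom lam T b) : expfam_mean lam T b = c <-> mean_eq lam T c b.
  have Z0 := lint1_gt0 lam T mT linT b K0 bd.
  rewrite mean_eqE //; split=> [<- k|h].
    by rewrite mxE expfam_expectation ?divfK ?gt_eqF //; exact: tame_stat.
  apply/colP => k; rewrite mxE expfam_expectation; last exact: tame_stat.
    by rewrite h mulfK // gt_eqF.
  exact: bd.
split=> [[/(interior_natparam lam T mT) bd] /(meanE bd)//|[bd] /(meanE bd) mb].
by split=> //; apply/interior_natparam.
Qed.

Lemma expfam_nat_of_meanP c : expfam_meanspace lam T c ->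
  dom lam T (expfam_nat_of_mean lam T c) /\
  mean_eq lam T c (expfam_nat_of_mean lam T c).
Proof.
by move=> [b vb]; apply/expfam_valid_natE; exact: (xgetI 0 vb).
Qed.

Lemma expfam_nat_of_mean_eq c b : dom lam T b -> mean_eq lam T c b ->
  expfam_nat_of_mean lam T c = b.
Proof.
move=> bd bc; have [] := expfam_nat_of_meanP c.
  by exists b; apply/expfam_valid_natE.
by move=> nd nc; exact: (mean_eq_inj lam T mT linT c).
Qed.

Lemma covTE c i j : expfam_meanspace lam T c ->
  covT lam T c i j =
  lint lam T (fun y => shift_stat T c y i 0 * shift_stat T c y j 0)
    (expfam_nat_of_mean lam T c) /
  lint lam T (fun=> 1) (expfam_nat_of_mean lam T c).
Proof.
move=> /expfam_nat_of_meanP[nd nc].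
rewrite -expfam_expectation //; last exact: tameM.
rewrite mxE; congr Rintegral; apply/funext => y; congr (_ * _).
by rewrite mxE big_ord1 !mxE.
Qed.

Lemma covT_mulmx c v k : expfam_meanspace lam T c ->
  (covT lam T c *m v) k 0 =
  lint lam T (fun y => shift_stat T c y k 0 * dot v (shift_stat T c y))
    (expfam_nat_of_mean lam T c) /
  lint lam T (fun=> 1) (expfam_nat_of_mean lam T c).
Proof.
move=> mc; have [nd nc] := expfam_nat_of_meanP _ mc.
transitivity (lint lam T (fun y => \sum_j v j 0 *
    (shift_stat T c y k 0 * shift_stat T c y j 0)) (expfam_nat_of_mean lam T c) /
    lint lam T (fun=> 1) (expfam_nat_of_mean lam T c)).
  rewrite lint_sum //; last by move=> j; apply: tameM; [exact: tame_cst|exact: tameM].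
  rewrite mulr_suml mxE; apply: eq_bigr => j _.
  by rewrite covTE // lintZ //; [rewrite mulrC mulrA|exact: tameM].
congr (lint _ _ _ _ / _); apply/funext => y; rewrite dotE mulr_sumr.
by apply: eq_bigr => j _; rewrite mulrCA.
Qed.

Lemma covT_quadratic c v : expfam_meanspace lam T c ->
  dot v (covT lam T c *m v) =
  lint lam T (fun y => dot v (shift_stat T c y) ^+ 2)
    (expfam_nat_of_mean lam T c) /
  lint lam T (fun=> 1) (expfam_nat_of_mean lam T c).
Proof.
move=> mc; have [nd nc] := expfam_nat_of_meanP _ mc.
have td : tame T (fun y => dot v (shift_stat T c y)).
  under eq_fun do rewrite dotE.
  by apply: tame_sum => k; apply: tameM => //; exact: tame_cst.
transitivity (lint lam T (fun y => \sum_k v k 0 *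
    (shift_stat T c y k 0 * dot v (shift_stat T c y))) (expfam_nat_of_mean lam T c) /
    lint lam T (fun=> 1) (expfam_nat_of_mean lam T c)).
  rewrite lint_sum //; last by move=> j; apply: tameM; [exact: tame_cst|exact: tameM].
  rewrite mulr_suml dotE; apply: eq_bigr => k _.
  by rewrite covT_mulmx // lintZ //; [rewrite mulrA|exact: tameM].
congr (lint _ _ _ _ / _); apply/funext => y; rewrite expr2 {2}dotE mulr_suml.
by apply: eq_bigr => j _; rewrite mulrA.
Qed.

(** The quadratic form is the variance of [v . T]; if it vanished, [v . T] would be constant almost
    everywhere, against minimality. *)
Lemma covT_spd_pos c : expfam_meanspace lam T c -> spd (covT lam T c).
Proof.
move=> mc; have [nd nc] := expfam_nat_of_meanP _ mc; split=> [|v v0].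
  apply/matrixP => i j; rewrite mxE !covTE //; congr (lint _ _ _ _ / _).
  by apply/funext => y; rewrite mulrC.
rewrite -mulmxA -[X in 0 < X]/(dot v _) covT_quadratic //.
have Z0 := lint1_gt0 lam T mT linT _ K0 nd.
rewrite divr_gt0 // lt_neqAle eq_sym Rintegral_ge0 ?andbT; last first.
  by move=> y _; rewrite mulr_ge0 ?expR_ge0 ?sqr_ge0.
have td : tame T (fun y => dot v (shift_stat T c y) ^+ 2).
  have td1 : tame T (fun y => dot v (shift_stat T c y)).
    under eq_fun do rewrite dotE.
    by apply: tame_sum => k; apply: tameM => //; exact: tame_cst.
  by under eq_fun do rewrite expr2; exact: tameM.
apply: contra v0 => /eqP.
move=> /(ge0_Rintegral_eq0 _ _ (dom_integrable _ _ mT _ _ nd td)) h.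
apply/eqP/(linT _ (dot v c)); apply: filterS (h _) => y.
  move/eqP; rewrite mulf_eq0 expR_eq0 orbF sqrf_eq0 /shift_stat dotBr subr_eq0.
  by move/eqP.
by rewrite mulr_ge0 ?expR_ge0 ?sqr_ge0.
Qed.

End ExponentialFamily.

(** Here [e] and [f] are the sizes of the displacements of the mean and of the natural parameter.
    Smallness gives [rem <= f / 2], hence [f <= 2 B e], and the bound on [rem] becomes quadratic in
    [e]. *)
Lemma inverse_remainder {R : realType} (e f B F rem : R) :
  0 <= e -> 0 <= f -> 0 <= B -> 0 <= F -> F * (f + e) <= 2^-1 ->
  rem <= F * f * (f + e) -> f <= B * e + rem ->
  rem <= F * (2 * B) * (2 * B + 1) * e ^+ 2.
Proof.
move=> e0 f0 B0 F0 small h1 h2.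
have fB : f <= 2 * B * e.
  have : F * f * (f + e) <= f * 2^-1.
    have -> : F * f * (f + e) = f * (F * (f + e)) by ring.
    by rewrite ler_wpM2l.
  by lra.
apply: (le_trans h1).
have -> : F * (2 * B) * (2 * B + 1) * e ^+ 2 =
  F * ((2 * B * e) * (2 * B * e + e)) by ring.
rewrite -mulrA ler_wpM2l // ler_pM ?addr_ge0 //.
by rewrite lerD2r.
Qed.

Section RealChainRule.
Context {R : realType} {V : normedModType R}.

Lemma is_diff_comp1 (f df : V -> R) (g : R -> R) (g' : R) (x : V) :
  is_diff x f df -> is_derive (f x) 1 g g' ->
  is_diff x (g \o f) (fun v => g' * df v).
Proof.
move=> fd [gd gE].
have gdiff : differentiable g (f x) by apply/derivable1_diffP.
have gd' : is_diff (f x) g (fun h : R => g' * h).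
  split=> //; rewrite diff1E // derive1E gE.
  by apply/funext => h; rewrite /GRing.scale /= mulrC.
exact: is_diff_comp.
Qed.

Lemma is_diff_inv (f df : V -> R) (x : V) : f x != 0 -> is_diff x f df ->
  is_diff x (fun y => (f y)^-1) (fun v => - (f x) ^- 2 * df v).
Proof.
move=> fx0 [fd dE]; split; first exact: differentiableV.
by rewrite diffV // dE.
Qed.

End RealChainRule.

(** * The natural parameter as a differentiable function of the mean *)

Section NaturalParameter.
Context {R : realType} {d : measure_display} {Y : measurableType d} {K : nat}.
Variables (lam : {measure set Y -> \bar R}) (T : Y -> 'cV[R]_K).
Hypothesis minT : expfam_minimal lam T.
Hypothesis K0 : (0 < K)%N.

Let mT : forall k, measurable_fun setT (fun y => T y k 0). Proof. by case: minT. Qed.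

Let linT (c : 'cV[R]_K) (c0 : R) : {ae lam, forall y, dot c (T y) = c0} -> c = 0.
Proof. by case: minT => _; apply. Qed.

Let t1 : tame T (fun=> 1) := tame_cst T 1.

Let stat_tame c k : tame T (fun y => shift_stat T c y k 0).
Proof. exact: shift_stat_coord_tame. Qed.

(** The covariance is the Jacobian of the mean. The estimate concerns pairs [b'], [c'] linked by the
    mean equation, so that no regularity of [c' |-> b'] is presupposed. *)
Lemma mean_map_taylor c : expfam_meanspace lam T c ->
  let b := expfam_nat_of_mean lam T c in
  exists E r, [/\ 0 <= E, 0 < r & forall c' b', dom lam T b' ->
    mean_eq lam T c' b' -> `|b' - b| < r ->
    `|covT lam T c *m (b' - b) - (c' - c)| <=
      E * `|b' - b| * (`|b' - b| + `|c' - c|)].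
Proof.
move=> mc b; have [bd bc] := expfam_nat_of_meanP lam T minT K0 _ mc.
have Z0 := lint1_gt0 lam T mT linT b K0 bd.
have [C [r [C0 r0 h]]] := lint_taylor lam T mT b bd.
set Z := lint lam T (fun=> 1) b in Z0.
pose m := \col_k lint lam T (fun y => 1 * T y k 0) b.
(* [a] is the growth constant of the coordinates of [T - c], and [D] bounds the variation of the
   partition function on the ball of radius [r]. *)
pose a := 1 + `|c|; pose D := l1 m + C * r.
have a0 : 0 <= a by rewrite addr_ge0.
have D0 : 0 <= D by apply: addr_ge0; [exact: l1_ge0|rewrite mulr_ge0 // ltW].
have E0 : 0 <= (a * C + D) / Z.
  by rewrite divr_ge0 ?(ltW Z0) // addr_ge0 // mulr_ge0.
exists ((a * C + D) / Z), r; split => // c' b' b'd b'c' b'r.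
set v := b' - b in b'r *; have vb : v + b = b' by rewrite subrK.
have hZ : `|lint lam T (fun=> 1) b' - Z| <= D * `|v|.
  have := h (fun=> 1) 1 v (measurable_cst _) ler01 (one_le_1Dl1 T) b'r.
  rewrite vb mul1r -/m -/Z => hv.
  have -> : lint lam T (fun=> 1) b' - Z =
    (lint lam T (fun=> 1) b' - Z - dot v m) + dot v m by ring.
  apply: le_trans (ler_normD _ _) _; apply: le_trans (lerD hv (dot_le _ _)) _.
  rewrite /D mulrDl [l1 m * _]mulrC addrC lerD2l expr2 mulrA ler_wpM2r //.
  by rewrite ler_wpM2l // ltW.
apply: cV_norm_le => [|k].
  by rewrite mulr_ge0 ?addr_ge0 // mulr_ge0.
have hX : `|lint lam T (fun y => shift_stat T c y k 0) b' -
    Z * (covT lam T c *m v) k 0| <= a * C * `|v| ^+ 2.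
  have [mX _] := stat_tame c k.
  have := h _ a v mX a0; rewrite vb bc subr0 => hv.
  apply: le_trans (hv _ b'r) => [|y]; last first.
    rewrite /shift_stat !mxE; apply: le_trans (ler_normB _ _) _.
    have h1 := coord_le_l1 _ (T y) k; have h2 := mx_coord_norm_le _ _ c k 0.
    have h3 := l1_ge0 _ (T y); have h4 := normr_ge0 c.
    apply: le_trans (lerD h1 h2) _; rewrite /a; nra.
  rewrite covT_mulmx // mulrC divfK ?gt_eqF // -lint_dot //.
  (* Centring the second factor changes nothing, as the centred first moment vanishes at [b]. *)
  suff -> : lint lam T (fun y => shift_stat T c y k 0 * dot v (shift_stat T c y)) b =
    lint lam T (fun y => shift_stat T c y k 0 * dot v (T y)) b by [].
  transitivity (lint lam T (fun y => shift_stat T c y k 0 * dot v (T y) -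
      dot v c * shift_stat T c y k 0) b).
    congr lint; apply/funext => y.
    by rewrite {2}/shift_stat dotBr mulrBr [dot v c * _]mulrC.
  rewrite lintB //; last 2 first.
  - by apply: tameM => //; exact: tame_dot.
  - by apply: tameM => //; exact: tame_cst.
  by rewrite lintZ // bc mulr0 subr0.
(* The same integral, now from the mean equation of [b']; the comparison with [hX] leaves [Z' - Z]
   to control. *)
have hk : lint lam T (fun y => shift_stat T c y k 0) b' =
    (c' - c) k 0 * lint lam T (fun=> 1) b'.
  transitivity (lint lam T (fun y => T y k 0 - c k 0 * 1) b').
    by congr lint; apply/funext => y; rewrite /shift_stat !mxE mulr1.
  rewrite lintB // ?lintZ //; last 2 first.
  - exact: tame_stat.
  - by apply: tameM => //; exact: tame_cst.
  by rewrite ((iffLR (mean_eqE lam T minT c' b' b'd)) b'c' k) !mxE mulrBl.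
have hc := mx_coord_norm_le _ _ (c' - c) k 0.
move: hX; rewrite hk !mxE; move: hc; rewrite !mxE.
set q := c' k 0 - c k 0; set p := \sum_j _; set Z' := lint _ _ _ b' in hZ *.
set e := `|c' - c|; set f := `|v| => qe hX.
have e0 : 0 <= e by exact: normr_ge0.
have f0 : 0 <= f by exact: normr_ge0.
have -> : (a * C + D) / Z * f * (f + e) = Z^-1 * ((a * C + D) * f * (f + e)).
  by ring.
rewrite ler_pdivlMl // -{1}(gtr0_norm Z0) -normrM.
have -> : Z * (p - q) = - (q * Z' - Z * p) + q * (Z' - Z) by ring.
apply: le_trans (ler_normD _ _) _; rewrite normrN normrM.
have h5 : `|q| * `|Z' - Z| <= e * (D * f) by apply: ler_pM.
apply: le_trans (lerD hX h5) _; rewrite -/f -subr_ge0.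
have -> : (a * C + D) * f * (f + e) - (a * C * f ^+ 2 + e * (D * f)) =
  a * C * f * e + D * f ^+ 2 by ring.
by rewrite addr_ge0 // ?mulr_ge0 // sqr_ge0.
Qed.

(** Local existence supplies a nearby parameter of mean [v + c], uniqueness identifies it with
    [expfam_nat_of_mean], and the expansion of the mean is inverted. *)
Lemma is_diff_nat_of_mean c : expfam_meanspace lam T c ->
  is_diff c (expfam_nat_of_mean lam T) (mulmx (invmx (covT lam T c))).
Proof.
move=> mc; have [bd bc] := expfam_nat_of_meanP lam T minT K0 _ mc.
have [E [r [E0 r0 hE]]] := mean_map_taylor c mc.
set b := expfam_nat_of_mean lam T c in bd bc hE.
have covU := spd_unitmx (covT_spd_pos lam T minT K0 _ mc).
have [B B0 hB] := mulmx_bounded _ _ (invmx (covT lam T c)).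
pose F := B * E; have F0 : 0 <= F by rewrite mulr_ge0 // ltW.
have F1 : 0 < 4 * (F + 1) by rewrite mulr_gt0 // ltr_wpDl.
(* Chosen so that displacements below [r2] meet the smallness condition of [inverse_remainder]. *)
pose r2 := (4 * (F + 1))^-1; have r20 : 0 < r2 by rewrite invr_gt0.
have Fr2 : F * (r2 + r2) <= 2^-1.
  have -> : F * (r2 + r2) = (2 * F) * r2 by ring.
  rewrite /r2 ler_pdivrMr //; lra.
have rr0 : 0 < Num.min r r2 by rewrite lt_min r0 r20.
have [rho rho0 hrho] := mean_eq_local_exists lam T mT linT c b _ K0 bd bc rr0.
apply: (is_diff_remainder _ _ _ _ _ B (F * (2 * B) * (2 * B + 1))
  (Num.min rho r2)) => //; first by rewrite lt_min rho0 r20.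
move=> v; rewrite lt_min => /andP[vrho vr2].
have [|b' b'd []] := hrho (v + c); first by rewrite addrK.
rewrite lt_min => /andP[b'r b'r2] b'c'.
rewrite (expfam_nat_of_mean_eq lam T minT K0 _ _ b'd b'c') -/b.
have := hE _ _ b'd b'c' b'r; rewrite addrK => hw.
set w := b' - b in b'r b'r2 hw *.
have wE : w - invmx (covT lam T c) *m v =
    invmx (covT lam T c) *m (covT lam T c *m w - v).
  by rewrite mulmxBr mulKmx.
apply: (@inverse_remainder _ _ `|w|) => //; first exact: ltW.
- apply: le_trans Fr2; rewrite ler_wpM2l // lerD // ltW //.
- rewrite wE; apply: le_trans (hB _) _.
  by rewrite /F -!mulrA ler_wpM2l ?(ltW B0) // mulrA.
- rewrite -{1}[w](subrK (invmx (covT lam T c) *m v)) addrC.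
  by apply: le_trans (ler_normD _ _) _; rewrite lerD2r.
Qed.

Lemma is_diff_dotr (w : 'cV[R]_K) (b : 'cV[R]_K) : is_diff b (dotr w) (dotr w).
Proof.
apply: (@is_diff_remainder _ _ R^o _ (dotr w) _ (l1 w) 0 1) => // v.
  by rewrite /dotr mulrC; exact: dot_le.
by move=> _; rewrite raddfD /= addrK subrr normr0 mul0r.
Qed.

(** The logarithm is [b . T - ln Z(b)], and the gradient of [Z] over [Z] is the mean [c]. *)
Lemma is_diff_log_dens c yy : expfam_meanspace lam T c ->
  is_diff (expfam_nat_of_mean lam T c)
    (fun b => ln (expfam_dens lam T b yy)) (dotr (T yy - c)).
Proof.
move=> mc; have [bd bc] := expfam_nat_of_meanP lam T minT K0 _ mc.
set b := expfam_nat_of_mean lam T c in bd bc *.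
have Z0 := lint1_gt0 lam T mT linT b K0 bd.
have dZ := is_diff_lint1 lam T mT b bd.
have dV := is_diff_inv _ _ _ (lt0r_neq0 Z0) dZ.
have dE := is_diff_comp1 _ _ expR _ b (is_diff_dotr (T yy) b) (is_derive_expR _).
have dM := is_diffM dE dV.
have p0 : 0 < ((expR \o dotr (T yy)) * (fun y => (lint lam T (fun=> 1) y)^-1)) b.
  by rewrite mulr_gt0 ?expR_gt0 ?invr_gt0.
have := is_diff_comp1 _ _ (@ln R) _ b dM (is_derive1_ln p0).
have -> : @ln R \o ((expR \o dotr (T yy)) * (fun y => (lint lam T (fun=> 1) y)^-1)) =
    (fun b => ln (expfam_dens lam T b yy)).
  by apply/funext => b'; rewrite /expfam_dens expfam_ZE.
congr is_diff_def; apply/funext => v.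
set Z := lint lam T (fun=> 1) b in Z0 *; set x := expR (dotr (T yy) b).
(* The composed differential, in the form that the product and chain rules produce. *)
rewrite -[LHS]/((x * Z^-1)^-1 * (x * (- Z ^- 2 *
  dotr (\col_k lint lam T (fun y => T y k 0) b) v) + Z^-1 * (x * dotr (T yy) v))).
have -> : dotr (\col_k lint lam T (fun y => T y k 0) b) v = Z * dotr c v.
  rewrite /dotr !dotE mulr_sumr; apply: eq_bigr => k _; rewrite mxE.
  by rewrite ((iffLR (mean_eqE lam T minT c b bd)) bc k) -/Z; ring.
have -> : dotr (T yy - c) v = dotr (T yy) v - dotr c v by rewrite /dotr dotBr.
have x0 : x != 0 by rewrite expR_eq0.
by field; rewrite x0 (lt0r_neq0 Z0).
Qed.

Lemma is_diff_log_p_obs c yy : expfam_meanspace lam T c ->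
  is_diff c (fun c' => ln (p_obs lam T c' yy))
    (fun v => dot (T yy - c) (invmx (covT lam T c) *m v)).
Proof.
move=> mc; have dn := is_diff_nat_of_mean c mc.
have := is_diff_comp dn (is_diff_log_dens c yy mc).
by congr is_diff_def; apply/funext => v /=; rewrite /dotr dotC.
Qed.

End NaturalParameter.

Lemma ord_eq0_absurd n : n = 0%N -> 'I_n -> False.
Proof. by move=> -> []. Qed.

Lemma grad_cst {R : realType} n (a : R) (x : 'cV[R]_n) : grad (cst a) x = 0.
Proof. by apply/rowP => j; rewrite !mxE diff_cst. Qed.

(** * Score and Fisher matrix *)

Section Score.
Context {R : realType} {d : measure_display} {Y : measurableType d} {K : nat}.
Variables (lam : {measure set Y -> \bar R}) (T : Y -> 'cV[R]_K).
Hypothesis minT : expfam_minimal lam T.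

Lemma covT_spd c : expfam_meanspace lam T c -> spd (covT lam T c).
Proof.
(* The empty statistic is treated apart: positivity of the partition function was drawn from a
   coordinate of [T]. *)
move=> mc; have [K0|K0] := posnP K; last exact: covT_spd_pos.
split=> [|v]; first by apply/matrixP => i; case: (ord_eq0_absurd _ K0 i).
by have -> : v = 0; [apply/colP => i; case: (ord_eq0_absurd _ K0 i)|rewrite eqxx].
Qed.

Lemma grad_log_p_obs n (h : 'cV[R]_n -> 'cV[R]_K) (x : 'cV[R]_n) yy :
  expfam_meanspace lam T (h x) -> differentiable h x ->
  grad (fun th => ln (p_obs lam T (h th) yy)) x =
  (T yy - h x)^T *m invmx (covT lam T (h x)) *m Jac h x.
Proof.
move=> mc dh; have [K0|K0] := posnP K.
  have hE : (fun th => ln (p_obs lam T (h th) yy)) = cst (ln (p_obs lam T (h x) yy)).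
    apply/funext => th; have -> : h th = h x; last exact: erefl.
    by apply/colP => i; case: (ord_eq0_absurd _ K0 i).
  have -> : Jac h x = 0 by apply/matrixP => i; case: (ord_eq0_absurd _ K0 i).
  by rewrite hE grad_cst mulmx0.
have dc := is_diff_comp (differentiableP dh)
  (is_diff_log_p_obs lam T minT K0 (h x) yy mc).
apply/rowP => j; rewrite mxE.
have -> : 'd (fun th => ln (p_obs lam T (h th) yy)) x (delta_mx j 0) =
    dot (T yy - h x) (invmx (covT lam T (h x)) *m 'd h x (delta_mx j 0)).
  by have [_ ->] := dc.
by rewrite diff_Jac /dot !mulmxA -colE mxE.
Qed.

(** Meant for [A = V^-1 H], where [V] is the covariance and [(T - c)^T A] is the score. *)
Lemma fisher_score n (A : 'M[R]_(K, n)) c : expfam_meanspace lam T c ->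
  EobsM lam T c (fun yy => ((T yy - c)^T *m A)^T *m ((T yy - c)^T *m A)) =
  A^T *m covT lam T c *m A.
Proof.
move=> mc; have [K0|K0] := posnP K.
  have -> : A = 0 by apply/matrixP => i; case: (ord_eq0_absurd _ K0 i).
  apply/matrixP => i j; rewrite mulmx0 !mxE /Eobs.
  under eq_Rintegral => y _ do rewrite mulmx0 mulmx0 mxE mul0r.
  by rewrite Rintegral_cst // mul0r.
have [mT _] := minT.
have [bd bc] := expfam_nat_of_meanP lam T minT K0 _ mc.
have tX k : tame T (fun y => shift_stat T c y k 0) by exact: shift_stat_coord_tame.
apply/matrixP => i j; rewrite mxE /Eobs.
transitivity (\int[lam]_y ((\sum_l \sum_k (A k i * A l j) *
    (shift_stat T c y k 0 * shift_stat T c y l 0)) * p_obs lam T c y)).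
  congr Rintegral; apply/funext => y; congr (_ * _).
  rewrite trmx_mul trmxK mxE big_ord1 mulrC !mxE mulr_suml.
  apply: eq_bigr => l _; rewrite mulr_sumr; apply: eq_bigr => k _.
  by rewrite /shift_stat !mxE; ring.
rewrite expfam_expectation //; last first.
  apply: tame_sum => l; apply: tame_sum => k.
  by apply: tameM; [exact: tame_cst|exact: tameM].
rewrite lint_sum //; last first.
  by move=> l; apply: tame_sum => k; apply: tameM; [exact: tame_cst|exact: tameM].
rewrite mulr_suml mxE; apply: eq_bigr => l _.
rewrite lint_sum //; last by move=> k; apply: tameM; [exact: tame_cst|exact: tameM].
rewrite mxE !mulr_suml; apply: eq_bigr => k _.
rewrite lintZ //; last exact: tameM.
by rewrite covTE // !mxE; ring.
Qed.

End Score.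

(** * The extended Kalman filter as a natural gradient *)

Section Step.
Context {R : realType} {n k : nat}.

(** [F] is the Jacobian of the flow and [G] that of its inverse. The relation between the rates
    makes [J' = eta' (Ppred^-1 + H^T V^-1 H)], the information form up to scale. *)
Lemma kalman_natural_gradient_step (F G J P : 'M[R]_n) (H : 'M[R]_(k, n))
    (V : 'M[R]_k) (eta eta' alpha : R) :
  let Ppred := F *m P *m F^T + alpha *: (F *m P *m F^T) in
  let gain := Ppred *m H^T *m invmx (H *m Ppred *m H^T + V) in
  let J' := (1 - eta') *: (G^T *m J *m G) + eta' *: (H^T *m invmx V *m H) in
  G *m F = 1%:M -> spd J -> spd V -> 0 < eta -> 0 <= alpha ->
  P = eta *: invmx J -> eta'^-1 = (1 + alpha)^-1 * eta^-1 + 1 ->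
  [/\ spd J', 0 < eta', (1%:M - gain *m H) *m Ppred = eta' *: invmx J' &
      gain = eta' *: (invmx J' *m H^T *m invmx V)].
Proof.
move=> Ppred gain J' GF sJ sV e0 a0 PE eE.
have [Fu GE] := unitmx_mulmx1 GF; have Gu : G \in unitmx by rewrite GE unitmx_inv.
have Ju := spd_unitmx sJ.
have a1 : 0 < 1 + alpha by rewrite ltr_pwDl.
pose q := (1 + alpha)^-1 * eta^-1.
have q0 : 0 < q by rewrite mulr_gt0 ?invr_gt0.
have e'0 : 0 < eta' by rewrite -invr_gt0 eE ltr_wpDl // ltW.
(* The recursion reads [1 / eta' = q + 1], so the decay [1 - eta'] reproduces the scale of
   [Ppred^-1 = q G^T J G]. *)
have e'q : 1 - eta' = eta' * q.
  rewrite -[q](addrK 1) -eE mulrBr mulr1 divff //; exact: lt0r_neq0.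
pose Jp := G^T *m J *m G; have sJp : spd Jp by exact: spd_congr.
have PpE : invmx Ppred = q *: Jp.
  have sq0 : 0 < (1 + alpha) * eta by rewrite mulr_gt0.
  have -> : Ppred = ((1 + alpha) * eta) *: (F *m invmx J *m F^T).
    by rewrite /Ppred PE -scalemxAr -scalemxAl -{1}[eta *: _]scale1r -scalerDl scalerA.
  apply/esym; apply: (proj2 (unitmx_mulmx1 _)).
  rewrite -scalemxAl -scalemxAr scalerA /q -invfM mulVf ?lt0r_neq0 // scale1r.
  rewrite /Jp GE !mulmxA mulmxKV // -!mulmxA (mulmxA J) mulmxV // mul1mx.
  by rewrite -trmx_mul mulmxV // trmx1.
have sPp : spd Ppred.
  by rewrite -[Ppred]invmxK PpE; apply/spd_inv/spd_scale.
have J'E : J' = eta' *: (invmx Ppred + H^T *m invmx V *m H).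
  by rewrite /J' e'q PpE scalerDr scalerA.
have sI : spd (invmx Ppred + H^T *m invmx V *m H).
  by apply: spdD; [exact: spd_inv|apply/psd_congr/spd_psd/spd_inv].
have sJ' : spd J' by rewrite J'E; exact: spd_scale.
have cov : (1%:M - gain *m H) *m Ppred = eta' *: invmx J'.
  rewrite (kalman_covariance_information sPp sV) J'E invmxZ_neq0 ?lt0r_neq0 //.
    by rewrite scalerA divff ?scale1r // lt0r_neq0.
  exact: spd_unitmx.
split=> //; rewrite {1}/gain (kalman_gain_information sPp sV) -/gain cov.
by rewrite -!scalemxAl.
Qed.

End Step.

(** * Trajectories in the charts *)

Section TrajectoryCharts.
Context {R : realType} {n : nat} {U : Type}.
Variables (f : 'cV[R]_n -> U -> 'cV[R]_n) (u : nat -> U).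
Variable finv : nat -> 'cV[R]_n -> 'cV[R]_n.

Lemma Phi_Phi_inv t th : Phi t (Phi_inv f u finv t th) = th.
Proof. by rewrite /Phi /Phi_inv leqnn subnn. Qed.

Lemma Phi_pred_Phi_inv t th : Phi t (Phi_inv f u finv t.+1 th) = finv t.+1 th.
Proof. by rewrite /Phi /Phi_inv leqnSn subSnn /= subn0. Qed.

(** Before time [t] each backward step is undone by [f]; from [t] on the recursion holds by
    construction. *)
Lemma Phi_inv_traj_space t th :
  (forall t, (0 < t)%N -> cancel (finv t) (fun s => f s (u t))) ->
  traj_space f u (Phi_inv f u finv t th).
Proof.
move=> finvK [//|k] _ /=; rewrite /Phi_inv.
have [kt|tk|<-] := ltngtP k t.
- by rewrite -(subnSK kt) /= subKn // finvK.
- by rewrite subSn ?(ltnW tk) //= addnS subnKC // ltnW.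
- by rewrite subnn subSnn /= addn1.
Qed.

(** In the chart at time [t] the model depends on the trajectory through its coordinate alone. *)
Lemma score_chartE (d : measure_display) (Y : measurableType d) K
    (lam : {measure set Y -> \bar R}) (T : Y -> 'cV[R]_K)
    (h : 'cV[R]_n -> U -> 'cV[R]_K) t yy v :
  score_chart lam T f finv h u t yy v =
  grad (fun x => ln (p_obs lam T (h x (u t)) yy)) (Phi t v).
Proof.
have E : (fun x => ln (model lam T h u t yy (Phi_inv f u finv t x))) =
    (fun x => ln (p_obs lam T (h x (u t)) yy)).
  by apply/funext => x; rewrite /model Phi_Phi_inv.
exact: (congr1 (fun g : 'cV[R]_n -> R => grad g (Phi t v)) E).
Qed.

End TrajectoryCharts.

Theorem theorem5
  (R : realType) (d : measure_display) (Y : measurableType d)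
  (lam : {measure set Y -> \bar R}) (K n : nat) (U : Type)
  (T : Y -> 'cV[R]_K)
  (f : 'cV[R]_n -> U -> 'cV[R]_n) (finv : nat -> 'cV[R]_n -> 'cV[R]_n)
  (h : 'cV[R]_n -> U -> 'cV[R]_K)
  (u : nat -> U) (y : nat -> Y)
  (alpha eta gamma : nat -> R)
  (s0 : 'cV[R]_n) (P0 J0 : 'M[R]_n) :
  (* exponential family: measurable, minimal sufficient statistics *)
  expfam_minimal lam T ->
  (* f(., u_t) is a diffeomorphism of R^n with inverse finv t (t >= 1) *)
  (forall t, (0 < t)%N -> cancel (fun s => f s (u t)) (finv t)) ->
  (forall t, (0 < t)%N -> cancel (finv t) (fun s => f s (u t))) ->
  (forall t, (0 < t)%N -> forall s, differentiable (fun x => f x (u t)) s) ->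
  (forall t, (0 < t)%N -> forall s, differentiable (finv t) s) ->
  (* h smooth in the state *)
  (forall t, (0 < t)%N -> forall s, differentiable (fun x => h x (u t)) s) ->
  (* the EKF predictions are valid mean parameters *)
  (forall t, (0 < t)%N ->
     expfam_meanspace lam T (ekf_yhat lam T f h u y alpha s0 P0 t)) ->
  (* fading-memory weights, initial SPD matrices *)
  (forall t, 0 <= alpha t) ->
  spd P0 -> spd J0 ->
  (* hyperparameter relations *)
  P0 = eta 0%N *: invmx J0 ->
  (forall t, (0 < t)%N -> gamma t = eta t) ->
  (forall t, (0 < t)%N ->
     (eta t)^-1 = (1 + alpha t)^-1 * (eta t.-1)^-1 + 1) ->
  forall t : nat,
    let st := (ekf lam T f h u y alpha s0 P0 t).1 in
    let Pt := (ekf lam T f h u y alpha s0 P0 t).2 in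
    let vt := (ngd lam T f finv h u y s0 eta gamma J0 t).1 in
    let Jt := (ngd lam T f finv h u y s0 eta gamma J0 t).2 in
    traj_space f u vt /\ Phi t vt = vt t /\ vt t = st /\ Pt = eta t *: invmx Jt.
Proof.
move=> minT fK finvK df dfinv dh mean alpha0 sP0 sJ0 P0E gammaE etaE t st Pt vt Jt.
(* In dimension 0 no vector is nonzero, so the sign of [eta 0] cannot be read off [P0]; all
   equalities are then trivial. *)
have [n0|n0] := posnP n.
  have cV0 (a b : 'cV[R]_n) : a = b.
    by apply/colP => i; case: (ord_eq0_absurd _ n0 i).
  have M0 (a b : 'M[R]_n) : a = b.
    by apply/matrixP => i; case: (ord_eq0_absurd _ n0 i).
  by split; [move=> k _; exact: cV0|split; [|split; [exact: cV0|exact: M0]]].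
(* The induction also carries positivity of the metric and of the learning rate. *)
suff [tS vE PE _ _] : [/\ traj_space f u vt, vt t = st, Pt = eta t *: invmx Jt,
    spd Jt & 0 < eta t] by [].
rewrite {}/st {}/Pt {}/vt {}/Jt; elim: t => [|t [tS vE PE sJ e0]].
  split=> //=; first exact: Phi_inv_traj_space.
  have iJ := spd_inv sJ0.
  (* [0 < eta 0] follows by comparing the quadratic forms of [P0] and [invmx J0] at one nonzero
     vector. *)
  have v0 : (const_mx 1 : 'cV[R]_n) != 0.
    apply/eqP => /colP /(_ (Ordinal n0)); rewrite !mxE => /eqP.
    by rewrite oner_eq0.
  move: (sP0) => [_ /(_ _ v0)]; rewrite P0E -scalemxAr -scalemxAl mxE.
  by rewrite pmulr_lgt0 //; case: iJ => _; exact.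
have mt := mean t.+1 isT; rewrite /ekf_yhat /= in mt.
have eE := etaE t.+1 isT; rewrite /= in eE.
rewrite /=.
set vp := (ngd _ _ _ _ _ _ _ _ _ _ _ t).1 in tS vE *.
set Jp := (ngd _ _ _ _ _ _ _ _ _ _ _ t).2 in PE sJ *.
set s := (ekf _ _ _ _ _ _ _ _ _ t).1 in vE mt *.
set P := (ekf _ _ _ _ _ _ _ _ _ t).2 in PE *.
(* Reading the old trajectory at time [t + 1] performs the prediction step, so both algorithms
   linearize [h] at the same point. *)
have thE : Phi t.+1 vp = f s (u t.+1) by rewrite /Phi (tS t.+1 isT) /= vE.
set th := f s (u t.+1) in mt thE *; set yhat := h th (u t.+1) in mt *.
have scoreE yy : score_chart lam T f finv h u t.+1 yy vp =
    (T yy - yhat)^T *m (invmx (covT lam T yhat) *m Hjac h u t.+1 th).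
  rewrite score_chartE thE mulmxA.
  exact: (grad_log_p_obs lam T minT n (fun x => h x (u t.+1)) th yy mt (dh t.+1 isT th)).
have sV := covT_spd lam T minT _ mt.
have fisherE : EobsM lam T yhat (fun yy => (score_chart lam T f finv h u t.+1 yy vp)^T *m
     score_chart lam T f finv h u t.+1 yy vp) =
    (Hjac h u t.+1 th)^T *m invmx (covT lam T yhat) *m Hjac h u t.+1 th.
  under eq_fun do rewrite scoreE.
  rewrite (fisher_score lam T minT n _ _ mt) trmx_mul trmx_inv (proj1 sV) !mulmxA.
  by rewrite mulmxKV; [exact: erefl|exact: spd_unitmx].
have tauE : (fun x => Phi t (Phi_inv f u finv t.+1 x)) = finv t.+1.
  by apply/funext => x; exact: Phi_pred_Phi_inv.
(* The chart change from [t + 1] to [t] is the inverse flow, whose Jacobian at the prediction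
   inverts that of the flow at [s]. *)
have GF : Jac (finv t.+1) th *m Fjac f u t.+1 s = 1%:M.
  exact: (Jac_inverse _ _ _ _ (fK t.+1 isT) (df t.+1 isT s) (dfinv t.+1 isT _)).
have [sJ' e'0 covE gainE] := kalman_natural_gradient_step _ _ _ _
  (Hjac h u t.+1 th) _ _ _ _ GF sJ sV e0 (alpha0 t.+1) PE eE.
rewrite thE /tensor_chart_change tauE fisherE (gammaE t.+1 isT) scoreE.
split; [exact: Phi_inv_traj_space| |exact: covE|exact: sJ'|exact: e'0].
(* Gain times innovation is the learning rate times the natural gradient of the log-likelihood. *)
rewrite -[LHS]/(Phi t.+1 _) Phi_Phi_inv gainE; congr (_ + _).
by rewrite -scalemxAl !trmx_mul trmxK trmx_inv (proj1 sV) !mulmxA.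
Qed.
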